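(* Let $\mathcal A$ be the quantized abelian Coulomb branch with lattice $Y$, weights $\xi_1,\dots,\xi_n$ and flavors $b_1,\dots,b_n$ (see context), let $\zeta\in\mathfrak t^*$, and let $g$ be the automorphism of $\mathcal A$ with $g(r^\lambda)=e^{2\pi \mathrm i\zeta(\lambda)}r^\lambda$ and $g|_{\mathbb C[\mathfrak t]}=\mathrm{id}$. Let $T$ be a $g$-twisted trace on $\mathcal A$ with exponential generating function $u_T$. Let $I$ be the set of all lines (one-dimensional linear subspaces) in $\mathfrak t$ that can be obtained as an intersection of hyperplanes $\xi_j=0$, and for each $l\in I$ let $\lambda_l\in Y$ be a shortest nonzero coweight in $l$. Then $$u_T=\frac{\sum_{\mu} S_{\mu}e^{\mu}}{\prod_{l\in I}\big(e^{\frac12\lambda_l}-e^{2\pi \mathrm i \zeta(\lambda_l)}e^{-\frac12\lambda_l}\big)},$$ where the sum in the numerator is over some finite set of $\mu\in\mathfrak t$ and each $S_\mu$ is a polynomial on $\mathfrak t^*$. In particular, $u_T$ is the Taylor expansion at zero of a meromorphic function on $\mathfrak t^*$.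
   Context: Setting. $\mathfrak t\cong\mathbb C^d$ is the Lie algebra of the torus $(\mathbb C^\times)^d$, $Y\subset\mathfrak t$ its cocharacter lattice, $\mathbb C[\mathfrak t]=S(\mathfrak t^* )$. Weights $\xi_1,\dots,\xi_n\in\operatorname{Hom}(Y,\mathbb Z)\subset\mathfrak t^*$ and flavors $b_1,\dots,b_n\in\mathbb C$ are given. The quantized abelian Coulomb branch $\mathcal A$ is the associative algebra that is a free $\mathbb C[\mathfrak t]$-module with basis $r^\lambda$, $\lambda\in Y$, containing $\mathbb C[\mathfrak t]$ as a subalgebra ($r^0=1$), with relations $[r^\lambda,\alpha]=\alpha(\lambda)r^\lambda$ for $\alpha\in\mathfrak t^*$, and $r^\lambda r^\mu=\prod_{i=1}^n\tilde A_i(\lambda,\mu)\,r^{\lambda+\mu}$, where, with $d(a,b)=0$ if $ab\ge 0$ and $d(a,b)=\min(|a|,|b|)$ otherwise, $\tilde A_i(\lambda,\mu)=\prod_{j=1}^{d(\xi_i(\lambda),\xi_i(\mu))}(\xi_i+b_i+\xi_i(\lambda)-j+\tfrac12)$ if $\xi_i(\lambda)\ge0\ge\xi_i(\mu)$, $\tilde A_i(\lambda,\mu)=\prod_{j=1}^{d(\xi_i(\lambda),\xi_i(\mu))}(\xi_i+b_i+\xi_i(\lambda)+j-\tfrac12)$ if $\xi_i(\lambda)\le0\le\xi_i(\mu)$, and $\tilde A_i(\lambda,\mu)=1$ otherwise. A linear map $T:\mathcal A\to\mathbb C$ is a $g$-twisted trace if $T(ab)=T(bg(a))$ for all $a,b\in\mathcal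 A$. The exponential generating function of $T$ is the formal power series at $0$ on $\mathfrak t^*$ $$u_T(y)=\sum_{j_1,\dots,j_d\ge0}\frac{y_1^{j_1}\cdots y_d^{j_d}}{j_1!\cdots j_d!}\,T(x_1^{j_1}\cdots x_d^{j_d}),$$ where $x_1,\dots,x_d$ is a basis of $\mathfrak t^*$ and $y_1,\dots,y_d$ is the dual basis of $\mathfrak t$, viewed as linear coordinates on $\mathfrak t^*$ (this is independent of the basis). Elements $\mu\in\mathfrak t$ are viewed as linear functions on $\mathfrak t^*$, and $e^\mu$ is the exponential of this function. *)

(* Defs.v *)
From HB Require Import structures.
From mathcomp Require Import all_boot all_order all_algebra complex.
From mathcomp Require Import mpoly.
From mathcomp Require Import boolp classical_sets reals topology normedtype.
From mathcomp Require Import sequences exp trigo.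
Import Order.TTheory GRing.Theory Num.Theory numFieldNormedType.Exports.

Set Implicit Arguments.
Unset Strict Implicit.
Unset Printing Implicit Defensive.

Local Open Scope classical_set_scope.
Local Open Scope ring_scope.

(* R[i], named as a numClosedFieldType so that the topology which
   MathComp-Analysis puts on numeric fields is inferred for it. *)
Definition Cx (R : realType) : numClosedFieldType := R[i]%C.

(* Conventions.  The torus has rank d.  Y = Z^d and Hom(Y, Z) = Z^d are both
   'rV[int]_d, and t = C^d and t^* = C^d are both 'rV[Cx R]_d, in dual bases, so
   that [dot] is in all cases the duality pairing.  Both C[t] and the algebra of
   polynomials on t^* are {mpoly (Cx R)[d]}: the variable 'X_k is the coordinate
   x_k of t for the former, and the coordinate y_k of t^* for the latter. *)

Definition dot (K : pzRingType) (d : nat) (u v : 'rV[K]_d) : K :=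
  \sum_k u 0 k * v 0 k.

Section Algebra.
Variables (R : realType) (d : nat).
Local Notation C := (Cx R).
Local Notation Y := 'rV[int]_d.

Definition toC (v : Y) : 'rV[C]_d := map_mx intr v.

Definition expC (z : C) : C :=
  ((expR (complex.Re z) * cos (complex.Im z))
   +i* (expR (complex.Re z) * sin (complex.Im z)))%C.

(* alpha \in t^*, viewed as an element of C[t]. *)
Definition linpoly (alpha : 'rV[C]_d) : {mpoly C[d]} :=
  \sum_k alpha 0 k *: 'X_k.

Definition dmin (a b : int) : nat :=
  if 0 <= a * b then 0%N else minn `|a|%N `|b|%N.

Definition Atilde (xi : Y) (b : C) (lam mu : Y) : {mpoly C[d]} :=
  let a := dot xi lam in
  let c := dot xi mu in
  if (0 <= a) && (c <= 0) then
    \prod_(1 <= j < (dmin a c).+1)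
      (linpoly (toC xi) + (b + a%:~R - j%:R + 2%:R^-1)%:MP)
  else if (a <= 0) && (0 <= c) then
    \prod_(1 <= j < (dmin a c).+1)
      (linpoly (toC xi) + (b + a%:~R + j%:R - 2%:R^-1)%:MP)
  else 1.

(* A, with structure map iota : C[t] -> A and elements r lam, is the quantized
   abelian Coulomb branch.  These conditions determine (A, iota, r) up to a
   unique isomorphism; iota is injective by cb_r0 and cb_free. *)
Record is_coulomb_branch (n : nat) (xi : 'I_n -> Y) (b : 'I_n -> C)
    (A : algType C) (iota : {lrmorphism {mpoly C[d]} -> A}) (r : Y -> A) : Prop :=
  IsCoulombBranch {
    cb_span : forall a : A, exists (s : seq Y) (c : Y -> {mpoly C[d]}),
      a = \sum_(lam <- s) iota (c lam) * r lam;
    cb_free : forall (s : seq Y) (c : Y -> {mpoly C[d]}), uniq s ->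
      \sum_(lam <- s) iota (c lam) * r lam = 0 ->
      forall lam, lam \in s -> c lam = 0;
    cb_r0 : r 0 = 1;
    cb_comm : forall (lam : Y) (alpha : 'rV[C]_d),
      r lam * iota (linpoly alpha) - iota (linpoly alpha) * r lam
        = dot alpha (toC lam) *: r lam;
    cb_mul : forall lam mu : Y,
      r lam * r mu = iota (\prod_i Atilde (xi i) (b i) lam mu) * r (lam + mu)
  }.

Definition twist_factor (zeta : 'rV[C]_d) (lam : Y) : C :=
  expC (((0 +i* (2%:R * pi))%C : C) * dot zeta (toC lam)).

Definition is_twist (A : algType C) (iota : {lrmorphism {mpoly C[d]} -> A})
    (r : Y -> A) (zeta : 'rV[C]_d) (g : {lrmorphism A -> A}) : Prop :=
  [/\ bijective g,
      forall lam, g (r lam) = twist_factor zeta lam *: r lam &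
      forall p, g (iota p) = iota p].

Definition is_twisted_trace (A : algType C) (g : A -> A) (T : {scalar A}) : Prop :=
  forall a b : A, T (a * b) = T (b * g a).

Definition hyperplane (xi : Y) : {vspace 'rV[C]_d} :=
  lker (linfun (mulmxr (toC xi)^T)).

(* J may be empty: the empty intersection is t, which is a line when d = 1. *)
Definition lines (n : nat) (xi : 'I_n -> Y) : seq {vspace 'rV[C]_d} :=
  undup [seq W <- [seq (\bigcap_(j in J) hyperplane (xi j))%VS | J : {set 'I_n}]
        | \dim W == 1%N].

(* On a line all norms order the coweights in the same way. *)
Definition is_shortest (l : {vspace 'rV[C]_d}) (lam : Y) : Prop :=
  [/\ lam != 0, toC lam \in l &
      forall mu : Y, mu != 0 -> toC mu \in l -> dot lam lam <= dot mu mu].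

End Algebra.

Section PowerSeries.
Variables (R : realType) (d : nat).
Local Notation C := (Cx R).

(* C[[y_1, ..., y_d]]: F m is the coefficient of y^m. *)
Definition fps := 'X_{1..d} -> C.

Definition fps_one : fps := fun m => (m == 0%MM)%:R.

(* Same shape as mcoeffM. *)
Definition fps_mul (F G : fps) : fps := fun m =>
  \sum_(k : 'X_{1..d < (mdeg m).+1, (mdeg m).+1} | m == (k.1 + k.2)%MM)
    F k.1 * G k.2.

Definition fps_poly (S : {mpoly C[d]}) : fps := fun m => S@_m.

Definition mfact (m : 'X_{1..d}) : nat := \prod_k (m k)`!.

(* e^mu = exp (\sum_k mu_k y_k). *)
Definition fps_exp (mu : 'rV[C]_d) : fps := fun m =>
  (\prod_k mu 0 k ^+ m k) / (mfact m)%:R.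

(* u = N / D; D need not be invertible, so this is meant in the field of
   fractions of the domain C[[y_1, ..., y_d]]. *)
Definition fps_is_fraction (u N D : fps) : Prop :=
  (exists m, D m != 0) /\ forall m, fps_mul u D m = N m.

Definition exp_genfun (A : algType C) (iota : {lrmorphism {mpoly C[d]} -> A})
    (T : {scalar A}) : fps :=
  fun m => T (iota 'X_[m]) / (mfact m)%:R.

Definition monom (z : 'rV[C]_d) (m : 'X_{1..d}) : C := \prod_k z 0 k ^+ m k.

(* On a neighbourhood of p, the series \sum_m a_m (z - p)^m converges
   absolutely to f z; thus a is the Taylor expansion of f at p. *)
Definition has_expansion (f : 'rV[C]_d -> C) (p : 'rV[C]_d) (a : fps) : Prop :=
  \forall z \near p,
    (exists B : C, forall N : nat,
       \sum_(m : 'X_{1..d < N}) `|a m * monom (z - p) m| <= B) /\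
    (fun N : nat => \sum_(m : 'X_{1..d < N}) a m * monom (z - p) m) @ \oo --> f z.

Definition holomorphic_at (f : 'rV[C]_d -> C) (p : 'rV[C]_d) : Prop :=
  exists a : fps, has_expansion f p a.

(* Local quotients of holomorphic functions whose denominator has a nonzero
   germ; the values of f at the zeros of den are unconstrained. *)
Definition meromorphic (f : 'rV[C]_d -> C) : Prop :=
  forall p : 'rV[C]_d, exists num den : 'rV[C]_d -> C,
    [/\ \forall z \near p, holomorphic_at num z,
        \forall z \near p, holomorphic_at den z,
        ~ (\forall z \near p, den z = 0) &
        \forall z \near p, den z != 0 -> f z = num z / den z].

End PowerSeries.

(* Numerator and denominator of u_T, as formal power series (fps_...) and as
   entire functions on t^* (fun_...). *)
Section Fraction.
Variables (R : realType) (d : nat).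
Local Notation C := (Cx R).
Local Notation Y := 'rV[int]_d.

Definition fps_num (M : seq 'rV[C]_d) (S : 'rV[C]_d -> {mpoly C[d]}) : fps R d :=
  fun m => \sum_(mu <- M) fps_mul (fps_poly (S mu)) (fps_exp mu) m.

Definition fun_num (M : seq 'rV[C]_d) (S : 'rV[C]_d -> {mpoly C[d]})
    (z : 'rV[C]_d) : C :=
  \sum_(mu <- M) (S mu).@[fun k => z 0 k] * expC (dot mu z).

Definition half_coweight (lam : Y) : 'rV[C]_d := 2%:R^-1 *: toC R lam.

Definition fps_den (zeta : 'rV[C]_d) (L : seq {vspace 'rV[C]_d})
    (lam : {vspace 'rV[C]_d} -> Y) : fps R d :=
  \big[@fps_mul R d / @fps_one R d]_(l <- L)
    (fun m => fps_exp (half_coweight (lam l)) m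
              - twist_factor zeta (lam l) * fps_exp (- half_coweight (lam l)) m).

Definition fun_den (zeta : 'rV[C]_d) (L : seq {vspace 'rV[C]_d})
    (lam : {vspace 'rV[C]_d} -> Y) (z : 'rV[C]_d) : C :=
  \prod_(l <- L)
    (expC (dot (half_coweight (lam l)) z)
     - twist_factor zeta (lam l) * expC (- dot (half_coweight (lam l)) z)).

End Fraction.

(* Main.v *)
Require Import Defs.
From HB Require Import structures.
From mathcomp Require Import all_boot all_order all_algebra complex.
From mathcomp Require Import mpoly.
From mathcomp Require Import boolp classical_sets reals topology normedtype.
From mathcomp Require Import sequences exp trigo.
From mathcomp Require Import ring ssrcomplements.
Import Order.TTheory GRing.Theory Num.Theory numFieldNormedType.Exports.
Local Open Scope ring_scope.

Set Implicit Arguments.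
Unset Strict Implicit.
Unset Printing Implicit Defensive.

(**
Write u for the generating function of T.  For a polynomial P, the functional
p |-> T(P p) has generating function P(d/dy) u, and p |-> T(p(x + v)) has
generating function e^v u.  The trace identity for r^l and p r^(-l) compares the
products r^l r^(-l) and r^(-l) r^l, which are polynomials differing by the
translation by l.  In symmetric form it says that
  P_l(d/dy) ((e^(l/2) - q_l e^(-l/2)) u) = 0,   q_l = e^(2 pi i zeta(l)),
where P_l is a product of factors xi_i + c, all with xi_i(l) nonzero
([trace_shift], [killed_trace]).

Let F be the product of u with the denominator, which has a factor
e^(l/2) - q_l e^(-l/2) for every line of the arrangement.  Multiplying a solution
of such an equation by another factor only replaces P_l by a product of two of
its translates, so F satisfies one equation of this kind for every line
([killed_shift_diffs]).  Suppose that the hyperplanes meet in 0 only.  If one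
factor xi_i + c is chosen in the equation of every line, the chosen xi_i span: a
nonzero common zero would lie in a flat of positive dimension, which contains a
line l of the arrangement ([line_in_flat]), whereas the factor chosen for l does
not vanish on l.  This makes the system for F finite-dimensional, with solutions
of the form sum_mu S_mu e^mu ([quasipoly_of_kills]).  The induction removes one
factor at a time; its core is that a series all of whose partial derivatives are
quasipolynomials is itself one ([quasipoly_of_partials]).  If the hyperplanes have
a nonzero common vector, there is also an integral one, l, with P_l = 1; then
(e^(l/2) - q_l e^(-l/2)) u = 0 and u = 0.

The rest is analytic.  The denominator may vanish at 0, and u must be shown to
converge there.  Each factor of the denominator has, for suitable weights of the
variables, a single monomial of least weight; comparing coefficients in the order
of their weight, a geometric bound on the product gives one on the other factor
([fps_div_bound]), and the same argument shows that such a factor is not a zero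
divisor.  Power series are evaluated by absolutely summable families, and the
Cauchy product ([sumsM]) turns u D = N into an identity of functions.  The zeros
of the denominator contain no open set because along a generic real direction
each factor has at most one zero ([fun_den_not_near0]).
*)

(** * Linear functionals on polynomials: translation, restriction and primitives *)

Section MpolyComplements.
Variables (K : comNzRingType) (d : nat).
Implicit Types (p q : {mpoly K[d]}) (m : 'X_{1..d}).

Lemma mnm_ind (P : 'X_{1..d} -> Prop) :
  P 0%MM -> (forall k m, P m -> P (U_(k) + m)%MM) -> forall m, P m.
Proof.
move=> P0 PS m; have [n] := ubnP (mdeg m); elim: n m => // n IH m.
rewrite ltnS => le_m_n; have [->//|m_n0] := eqVneq m 0%MM.
have /existsP [k mk] : [exists k, m k != 0%N].
  apply: contraNT m_n0 => /existsPn m0; apply/eqP/mnmP => k.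
  by have := m0 k; rewrite negbK mnm0E => /eqP.
have lek : (U_(k) <= m)%MM.
  by apply/mnm_lepP => j; rewrite mnm1E; case: eqP => // <-; rewrite lt0n.
rewrite -(submK lek) addmC; apply/PS/IH.
have : mdeg m = (mdeg (m - U_(k)) + 1)%N by rewrite -(mdeg1 k) -mdegD submK.
by move=> e; rewrite e addn1 in le_m_n.
Qed.

Lemma mpoly_ring_ind (P : {mpoly K[d]} -> Prop) :
    (forall c, P c%:MP) -> (forall k, P 'X_k) ->
    (forall p q, P p -> P q -> P (p + q)) ->
    (forall p q, P p -> P q -> P (p * q)) ->
  forall p, P p.
Proof.
move=> PC PX PD PM.
have Pm m : P 'X_[m].
  elim/mnm_ind: m => [|k m IH]; first by rewrite mpolyX0; apply: PC.
  by rewrite mpolyXD; apply: PM.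
elim/mpolyind => [|c m p _ _ IH]; first by rewrite -mpolyC0; apply: PC.
by apply: PD => //; rewrite -mul_mpolyC; apply: PM.
Qed.

Lemma mderiv_X j k : ('X_j : {mpoly K[d]})^`M(k) = (j == k)%:R.
Proof.
rewrite mderivX mnm1E; case: eqP => [->|_]; last by rewrite scale0r.
rewrite scale1r.
have -> : (U_(k) - U_(k) = 0 :> 'X_{1..d})%MM.
  by apply/mnmP => i; rewrite mnmBE mnm0E subnn.
by rewrite mpolyX0.
Qed.

Lemma mderivmS k m p : p^`M[U_(k) + m] = p^`M(k)^`M[m].
Proof. by rewrite mderivmDm mderivmU1m. Qed.

Lemma mderivm_XM k m p :
  ('X_k * p)^`M[m] = 'X_k * p^`M[m] + (m k)%:R *: p^`M[m - U_(k)].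
Proof.
elim/mnm_ind: m p => [|i m IH] p.
  by rewrite !mderivm0m mnm0E scale0r addr0.
rewrite !mderivmS mderivM mderiv_X mderivmD IH -mderivmS mnmDE mnm1E.
have [->|nik] := eqVneq i k.
  rewrite mul1r.
  have -> : (U_(k) + m - U_(k))%MM = m.
    by apply/mnmP => j; rewrite mnmBE mnmDE addnC addnK.
  have [mk0|mk_gt0] := posnP (m k).
    by rewrite mk0 scale0r addr0 addn0 scale1r addrC.
  have lek : (U_(k) <= m)%MM.
    by apply/mnm_lepP => j; rewrite mnm1E; case: eqP => // <-.
  have em : (U_(k) + (m - U_(k)))%MM = m by rewrite addmC submK.
  rewrite -mderivmS em natrD scalerDl scale1r.
  exact: addrCA.
rewrite add0n mul0r raddf0 add0r.
have [mk0|mk_gt0] := posnP (m k).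
  by rewrite mk0 !scale0r !addr0.
rewrite -mderivmS; congr (_ + _ *: _^`M[_]).
apply/mnmP => j; rewrite !(mnmDE, mnmBE) addnBA // (mnm1E k).
by case: eqP => // <-.
Qed.

End MpolyComplements.

(** Translation p(x) |-> p(x + v).  On generating functions, precomposition
    with it is multiplication by e^v.  It is locked because unification would
    otherwise unfold the substitution into sums over supports. *)
HB.lock Definition shift (R : realType) (d : nat) (v : 'rV[Cx R]_d)
    (p : {mpoly (Cx R)[d]}) : {mpoly (Cx R)[d]} :=
  p \mPo [tuple 'X_k + (v 0 k)%:MP | k < d].

(** Setting x_k = 0; on generating functions, precomposition with it is
    setting y_k = 0. *)
HB.lock Definition restr (R : realType) (d : nat) (k : 'I_d)
    (p : {mpoly (Cx R)[d]}) : {mpoly (Cx R)[d]} :=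
  p \mPo [tuple if j == k then 0 else 'X_j | j < d].

Section Functionals.
Variables (R : realType) (d : nat).
Local Notation C := (Cx R).
Local Notation Pol := {mpoly C[d]}.
Implicit Types (F G : Pol -> C) (p q : Pol) (m : 'X_{1..d}) (u v mu : 'rV[C]_d).

Lemma functionalD F : scalar F -> {morph F : p q / p + q}.
Proof. by move=> lF p q; have := lF 1 p q; rewrite scale1r mul1r. Qed.

Lemma functional0 F : scalar F -> F 0 = 0.
Proof.
by move=> lF; have := functionalD lF 0 0; rewrite addr0 => /eqP; rewrite -subr_eq subrr => /eqP.
Qed.

Lemma functionalZ F : scalar F -> forall a, {morph F : p / a *: p >-> a * p}.
Proof. by move=> lF a p; have := lF a p 0; rewrite addr0 functional0 // addr0. Qed.

Lemma functional_eq F G : scalar F -> scalar G ->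
  (forall m, F 'X_[m] = G 'X_[m]) -> F =1 G.
Proof.
move=> lF lG eFG; elim/mpolyind => [|c m p _ _ IH].
  by rewrite !functional0.
by rewrite lF lG eFG IH.
Qed.

Lemma shift_X v k : shift v 'X_k = 'X_k + (v 0 k)%:MP.
Proof. by rewrite !shift.unlock comp_mpolyXU -tnth_nth tnth_mktuple. Qed.

Lemma shiftC v c : shift v c%:MP = c%:MP.
Proof. rewrite shift.unlock; exact: comp_mpolyC. Qed.

Lemma shiftD v : {morph shift v : p q / p + q}.
Proof. move=> p q; rewrite shift.unlock; exact: comp_mpolyD. Qed.

Lemma shiftM v : {morph shift v : p q / p * q}.
Proof. move=> p q; rewrite shift.unlock; exact: rmorphM. Qed.

Lemma shift_linear v : linear (shift v).
Proof. move=> a p q; rewrite shift.unlock; exact: linearP. Qed.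

Lemma shift_poly0 v : shift v 0 = 0.
Proof. by rewrite -mpolyC0 shiftC. Qed.

Lemma shiftZ v a : {morph shift v : p / a *: p}.
Proof. by move=> p; rewrite -!mul_mpolyC shiftM shiftC. Qed.

Lemma shift0 p : shift 0 p = p.
Proof.
elim/mpoly_ring_ind: p => [c|k|p q IHp IHq|p q IHp IHq].
- by rewrite shiftC.
- by rewrite shift_X mxE mpolyC0 addr0.
- by rewrite shiftD IHp IHq.
- by rewrite shiftM IHp IHq.
Qed.

Lemma shift_shift u v p : shift u (shift v p) = shift (u + v) p.
Proof.
elim/mpoly_ring_ind: p => [c|k|p q IHp IHq|p q IHp IHq].
- by rewrite !shiftC.
- by rewrite shift_X shiftD shift_X shiftC shift_X mxE mpolyCD addrA.
- by rewrite !shiftD IHp IHq.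
- by rewrite !shiftM IHp IHq.
Qed.

Lemma shift_linpoly v alpha :
  shift v (linpoly alpha) = linpoly alpha + (dot alpha v)%:MP.
Proof.
rewrite /linpoly (big_morph _ (shiftD v) (shift_poly0 v)) /dot.
rewrite raddf_sum -big_split; apply: eq_bigr => k _ /=.
by rewrite shiftZ shift_X scalerDr -!mul_mpolyC mpolyCM.
Qed.

Lemma mderiv_shift v k p : (shift v p)^`M(k) = shift v (p^`M(k)).
Proof.
elim/mpoly_ring_ind: p => [c|j|p q IHp IHq|p q IHp IHq].
- by rewrite shiftC mderivC -mpolyC0 shiftC.
- by rewrite shift_X mderivD mderivC mderiv_X addr0 -mpolyC_nat shiftC.
- by rewrite shiftD !mderivD shiftD IHp IHq.
- by rewrite shiftM !mderivM shiftD !shiftM IHp IHq.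
Qed.

Lemma mderivm_shift v m p : (shift v p)^`M[m] = shift v (p^`M[m]).
Proof.
elim/mnm_ind: m p => [|k m IH] p; first by rewrite !mderivm0m.
by rewrite !mderivmS mderiv_shift IH.
Qed.

(** The functional whose exponential generating function is y^m e^mu. *)
Definition diff_at mu m : Pol -> C := fun p => (p^`M[m]).@[fun k => mu 0 k].

(** The functionals whose generating function is a finite sum of terms
    S_mu(y) e^mu with S_mu a polynomial. *)
Definition quasipoly F := exists s : seq (C * 'rV[C]_d * 'X_{1..d}),
  forall p, F p = \sum_(t <- s) t.1.1 * diff_at t.1.2 t.2 p.

Lemma diff_at_scalar mu m : scalar (diff_at mu m).
Proof.
by move=> a p q; rewrite /diff_at mderivmD mderivmZ mevalD mevalZ.
Qed.

Lemma quasipoly_ext F G : F =1 G -> quasipoly F -> quasipoly G.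
Proof. by move=> e [s sP]; exists s => p; rewrite -e. Qed.

Lemma quasipoly0 : quasipoly (fun=> 0).
Proof. by exists [::] => p; rewrite big_nil. Qed.

Lemma quasipoly_diff_at mu m : quasipoly (diff_at mu m).
Proof. by exists [:: (1, mu, m)] => p; rewrite big_seq1 mul1r. Qed.

Lemma quasipolyD F G : quasipoly F -> quasipoly G -> quasipoly (fun p => F p + G p).
Proof. by move=> [s sP] [t tP]; exists (s ++ t) => p; rewrite big_cat sP tP. Qed.

Lemma quasipolyZ a F : quasipoly F -> quasipoly (fun p => a * F p).
Proof.
move=> [s sP]; exists [seq (a * t.1.1, t.1.2, t.2) | t <- s] => p.
by rewrite sP big_map mulr_sumr; apply: eq_bigr => t _; rewrite mulrA.
Qed.

Lemma quasipolyB F G : quasipoly F -> quasipoly G -> quasipoly (fun p => F p - G p).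
Proof.
move=> qF /(quasipolyZ (-1)) qG; apply: quasipoly_ext (quasipolyD qF qG) => p /=.
by rewrite mulN1r.
Qed.

Lemma quasipoly_sum (I : Type) (r : seq I) (f : I -> Pol -> C) :
  (forall i, quasipoly (f i)) -> quasipoly (fun p => \sum_(i <- r) f i p).
Proof.
move=> qf; elim: r => [|i r IH].
  by apply: quasipoly_ext quasipoly0 => p; rewrite big_nil.
by apply: quasipoly_ext (quasipolyD (qf i) IH) => p; rewrite big_cons.
Qed.

Lemma quasipoly_comp (phi : Pol -> Pol) F :
  (forall mu m, quasipoly (diff_at mu m \o phi)) -> quasipoly F -> quasipoly (F \o phi).
Proof.
move=> qphi [s sP].
apply: quasipoly_ext (quasipoly_sum s (fun t => quasipolyZ t.1.1 (qphi t.1.2 t.2))) => p /=.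
by rewrite sP.
Qed.

Lemma quasipoly_shift v F : quasipoly F -> quasipoly (F \o shift v).
Proof.
apply: quasipoly_comp => mu m; apply: quasipoly_ext (quasipoly_diff_at (mu + v) m) => p.
rewrite /diff_at /= mderivm_shift !shift.unlock comp_mpoly_meval.
by apply: meval_eq => k; rewrite tnth_mktuple mevalD mevalXU mevalC mxE.
Qed.

Lemma quasipoly_scalar F : quasipoly F -> scalar F.
Proof.
move=> [s sP] a p q; rewrite !sP mulr_sumr -big_split; apply: eq_bigr => t _ /=.
by rewrite diff_at_scalar mulrDr mulrCA.
Qed.

Lemma restr_X k j : restr k ('X_j : Pol) = if j == k then 0 else 'X_j.
Proof. by rewrite restr.unlock comp_mpolyXU -tnth_nth tnth_mktuple. Qed.

Lemma restrC k (c : C) : restr k (c%:MP : Pol) = c%:MP.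
Proof. rewrite restr.unlock; exact: comp_mpolyC. Qed.

Lemma restrD k : {morph @restr R d k : p q / p + q}.
Proof. move=> p q; rewrite restr.unlock; exact: comp_mpolyD. Qed.

Lemma restrM k : {morph @restr R d k : p q / p * q}.
Proof. move=> p q; rewrite restr.unlock; exact: rmorphM. Qed.

Lemma restr_linear k : linear (@restr R d k).
Proof. move=> a p q; rewrite restr.unlock; exact: linearP. Qed.

Lemma mderiv_restr k j p :
  (restr k p)^`M(j) = if j == k then 0 else restr k (p^`M(j)).
Proof.
elim/mpoly_ring_ind: p => [c|i|p q IHp IHq|p q IHp IHq].
- by rewrite restrC mderivC -mpolyC0 restrC if_same.
- rewrite restr_X mderiv_X -mpolyC_nat restrC; have [->|nik] := eqVneq i k.
    by rewrite mderiv0 eq_sym mpolyC_nat; case: eqP.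
  have [->|njk] := eqVneq j k; first by rewrite mderiv_X (negbTE nik).
  by rewrite mderiv_X mpolyC_nat.
- rewrite restrD !mderivD IHp IHq; case: eqP => _; first by rewrite addr0.
  by rewrite restrD.
- rewrite restrM !mderivM IHp IHq; case: eqP => _; first by rewrite mul0r mulr0 addr0.
  by rewrite restrD !restrM.
Qed.

Lemma mderivm0 m : (0 : Pol)^`M[m] = 0.
Proof. by have := mderivmZ m 0 (0 : Pol); rewrite !scale0r. Qed.

Lemma mderivm_restr k m p :
  (restr k p)^`M[m] = if m k == 0%N then restr k (p^`M[m]) else 0.
Proof.
elim/mnm_ind: m p => [|j m IH] p; first by rewrite !mderivm0m mnm0E.
rewrite !mderivmS mderiv_restr mnmDE mnm1E.
have [->|njk] := eqVneq j k; first by rewrite mderivm0.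
by rewrite IH.
Qed.

Lemma quasipoly_restr k F : quasipoly F -> quasipoly (F \o restr k).
Proof.
apply: quasipoly_comp => mu m; have [mk0|mkn0] := eqVneq (m k) 0%N; last first.
  apply: quasipoly_ext quasipoly0 => p.
  by rewrite /diff_at /= mderivm_restr (negbTE mkn0) meval0.
pose mu' := \row_j (if j == k then 0 else mu 0 j).
apply: quasipoly_ext (quasipoly_diff_at mu' m) => p.
rewrite /diff_at /= mderivm_restr mk0 eqxx restr.unlock comp_mpoly_meval.
apply: meval_eq => j; rewrite tnth_mktuple mxE.
by case: eqP => _; rewrite ?meval0 ?mevalXU.
Qed.

Lemma diff_at_XM mu m k p :
  diff_at mu m ('X_k * p) = mu 0 k * diff_at mu m p + (m k)%:R * diff_at mu (m - U_(k)) p.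
Proof. by rewrite /diff_at mderivm_XM mevalD mevalM mevalXU mevalZ. Qed.

(** Multiplication by X_k differentiates the generating function along y_k, so
    H is a primitive of y^m e^mu in the direction y_k.  If mu_k = 0 it is
    y_k^(m_k + 1) / (m_k + 1) times the other factors; otherwise integration by
    parts lowers m_k. *)
Lemma diff_at_primitive k mu m :
  exists2 H, quasipoly H & forall p, H ('X_k * p) = diff_at mu m p.
Proof.
have [muk0|muk] := eqVneq (mu 0 k) 0.
  exists (fun p => (m k).+1%:R^-1 * diff_at mu (U_(k) + m) p).
    exact/quasipolyZ/quasipoly_diff_at.
  move=> p; rewrite diff_at_XM muk0 mul0r add0r mnmDE mnm1E eqxx add1n.
  rewrite mulrA mulVf ?mul1r ?pnatr_eq0 //; congr diff_at.
  by apply/mnmP => j; rewrite mnmBE mnmDE addnC addnK.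
have [n] := ubnP (m k); elim: n m => // n IH m; rewrite ltnS => le_mk_n.
have [mk0|mk_gt0] := posnP (m k).
  exists (fun p => (mu 0 k)^-1 * diff_at mu m p); first exact/quasipolyZ/quasipoly_diff_at.
  by move=> p; rewrite diff_at_XM mk0 mul0r addr0 mulrA mulVf ?mul1r.
have [|H qH HP] := IH (m - U_(k))%MM.
  by rewrite mnmBE mnm1E eqxx subn1 -ltnS prednK.
exists (fun p => (mu 0 k)^-1 * (diff_at mu m p - (m k)%:R * H p)).
  by apply/quasipolyZ/quasipolyB; [apply: quasipoly_diff_at | apply: quasipolyZ].
by move=> p; rewrite diff_at_XM HP addrK mulrA mulVf ?mul1r.
Qed.

Lemma quasipoly_primitive k G : quasipoly G ->
  exists2 H, quasipoly H & forall p, H ('X_k * p) = G p.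
Proof.
move=> [s]; elim: s G => [|t s IH] G GP.
  exists (fun=> 0); first exact: quasipoly0.
  by move=> p; rewrite GP big_nil.
have [H1 qH1 H1P] := IH _ (fun=> erefl).
have [H2 qH2 H2P] := diff_at_primitive k t.1.2 t.2.
exists (fun p => t.1.1 * H2 p + H1 p); first by apply/quasipolyD => //; apply: quasipolyZ.
by move=> p; rewrite H1P H2P GP big_cons.
Qed.

Lemma restr_dvd k p : exists q, p = restr k p + 'X_k * q.
Proof.
elim/mpoly_ring_ind: p => [c|j|p q [p' ep] [q' eq]|p q [p' ep] [q' eq]].
- by exists 0; rewrite restrC mulr0 addr0.
- rewrite restr_X; case: eqP => [->|_]; first by exists 1; rewrite mulr1 add0r.
  by exists 0; rewrite mulr0 addr0.
- by exists (p' + q'); rewrite {1}ep {1}eq restrD; ring.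
- exists (p' * restr k q + restr k p * q' + 'X_k * p' * q').
  by rewrite {1}ep {1}eq restrM; ring.
Qed.

(** A series all of whose partial derivatives are quasipolynomials is one.
    Let H be a primitive of the k-th derivative.  Then F - H does not depend on
    y_k, so F differs from its restriction to y_k = 0 by the quasipolynomial
    H - H(y_k = 0).  Once every variable has been set to 0, only a constant
    remains. *)
Lemma quasipoly_of_partials F : scalar F ->
  (forall k, quasipoly (fun p => F ('X_k * p))) -> quasipoly F.
Proof.
pose restrs (s : seq 'I_d) (p : Pol) := foldr (@restr R d) p s.
have rD s : {morph restrs s : p q / p + q}.
  by elim: s => // k s IH p q /=; rewrite IH restrD.
have rZ s a : {morph restrs s : p / a *: p}.
  elim: s => // k s IH p /=; rewrite IH.
  by have := restr_linear k a (restrs s p) 0; rewrite !addr0 -mpolyC0 restrC mpolyC0 addr0.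
have rM s : {morph restrs s : p q / p * q}.
  by elim: s => // k s IH p q /=; rewrite IH restrM.
have rC s c : restrs s c%:MP = c%:MP.
  by elim: s => //= k s ->; rewrite restrC.
move=> lF qF; pose Z s := F \o restrs s.
have lZ s : scalar (Z s) by move=> a p q; rewrite /Z /= rD rZ lF.
have rX s j : restrs s 'X_j = if j \in s then 0 else 'X_j.
  elim: s => // k s IH; rewrite /= IH in_cons.
  case: (j \in s) => /=; first by rewrite -mpolyC0 restrC orbT.
  by rewrite restr_X orbF.
have qrs s G : quasipoly G -> quasipoly (G \o restrs s).
  elim: s G => [|k s IH] G qG; first exact: quasipoly_ext qG.
  exact: quasipoly_ext (IH _ (quasipoly_restr k qG)).
have qZ s k : quasipoly (fun p => Z s ('X_k * p)).
  rewrite /Z /=; case ks: (k \in s).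
    apply: quasipoly_ext quasipoly0 => p /=.
    by rewrite rM rX ks mul0r functional0.
  by apply: quasipoly_ext (qrs s _ (qF k)) => p /=; rewrite rM rX ks.
have step s k : quasipoly (Z (rcons s k)) -> quasipoly (Z s).
  move=> qZk; have [H qH HP] := quasipoly_primitive k (qZ s k).
  have := quasipolyD qZk (quasipolyB qH (quasipoly_restr k qH)).
  apply: quasipoly_ext => p /=.
  have -> : Z (rcons s k) p = Z s (restr k p).
    by rewrite /Z /restrs /= foldr_rcons.
  have [q ep] := restr_dvd k p.
  have lH := quasipoly_scalar qH.
  rewrite [in H p]ep [in Z s p]ep (functionalD lH) (functionalD (lZ s)) HP.
  by ring.
have : quasipoly (Z (enum 'I_d)).
  apply: quasipoly_ext (quasipolyZ (F 1) (quasipoly_diff_at 0 0%MM)).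
  apply: functional_eq => [a p q|//|m].
    by rewrite diff_at_scalar mulrDr mulrCA.
  rewrite /diff_at mderivm0m /Z /=.
  elim/mnm_ind: m => [|k m _]; first by rewrite mpolyX0 -mpolyC1 rC mevalC mpolyC1 mulr1.
  rewrite mpolyXD rM rX mem_enum mul0r functional0 // mevalM mevalXU mxE mul0r.
  by rewrite mulr0.
have : quasipoly (Z [::]) -> quasipoly F by apply: quasipoly_ext.
move=> + qE; apply; have : quasipoly (Z ([::] ++ enum 'I_d)) by [].
elim: (enum 'I_d) [::] => [|k t IH] s; first by rewrite cats0.
by move=> q; apply: step (k) _; apply: IH; rewrite cat_rcons.
Qed.

(** Multiplying the generating function by e^c turns the operators
    d/dy_k + c_k into d/dy_k. *)
Lemma quasipoly_of_affine_partials (c : 'rV[C]_d) F : scalar F ->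
  (forall k, quasipoly (fun p => F (('X_k + (c 0 k)%:MP) * p))) -> quasipoly F.
Proof.
move=> lF qF.
suff : quasipoly ((F \o shift c) \o shift (- c)).
  by apply: quasipoly_ext => p /=; rewrite shift_shift subrr shift0.
apply: quasipoly_shift; apply: quasipoly_of_partials.
  by move=> a p q /=; rewrite shift_linear lF.
move=> k; apply: quasipoly_ext (quasipoly_shift c (qF k)) => p /=.
by rewrite shiftM shift_X.
Qed.

End Functionals.

(** * Spanning sets of weights and flats of the hyperplane arrangement *)

Section Span.
Variables (R : realType) (d n : nat).
Local Notation C := (Cx R).
Local Notation Pol := {mpoly C[d]}.
Variable xi : 'I_n -> 'rV[int]_d.
Implicit Types (F : Pol -> C) (J : {set 'I_n}).

Definition flat J : {vspace 'rV[C]_d} := (\bigcap_(j in J) hyperplane R (xi j))%VS.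

Lemma mem_hyperplane (x : 'rV[int]_d) (u : 'rV[C]_d) :
  (u \in hyperplane R x) = (dot (toC R x) u == 0).
Proof.
rewrite /hyperplane memv_ker lfunE /=.
have -> : u *m (toC R x)^T = (dot (toC R x) u)%:M.
  apply/matrixP => i j; rewrite !ord1 !mxE eqxx /dot mulr1n.
  by apply: eq_bigr => k _; rewrite !mxE mulrC.
apply/eqP/eqP => [/matrixP/(_ 0 0)|->]; first by rewrite !mxE eqxx mulr1n.
by apply/matrixP => i j; rewrite !mxE mul0rn.
Qed.

Lemma mem_flat J u :
  reflect (forall j, j \in J -> dot (toC R (xi j)) u = 0) (u \in flat J).
Proof.
apply: (iffP idP) => [|h].
  rewrite memvE => /subv_bigcapP h j jJ.
  by apply/eqP; rewrite -mem_hyperplane memvE; apply: h.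
rewrite memvE; apply/subv_bigcapP => j jJ.
by rewrite -memvE mem_hyperplane h.
Qed.

Lemma dot_toC (u v : 'rV[int]_d) : dot (toC R u) (toC R v) = (dot u v)%:~R.
Proof.
by rewrite /dot rmorph_sum; apply: eq_bigr => k _; rewrite !mxE /= rmorphM.
Qed.

Lemma linpolyD (u v : 'rV[C]_d) : linpoly (u + v) = linpoly u + linpoly v.
Proof.
rewrite /linpoly -big_split; apply: eq_bigr => k _.
by rewrite mxE scalerDl.
Qed.

Lemma linpolyZ (a : C) (v : 'rV[C]_d) : linpoly (a *: v) = a *: linpoly v.
Proof.
by rewrite /linpoly scaler_sumr; apply: eq_bigr => k _; rewrite mxE scalerA.
Qed.

Lemma linpoly0 : linpoly (0 : 'rV[C]_d) = 0.
Proof. by have := linpolyZ 0 0; rewrite !scale0r. Qed.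

Lemma linpoly_delta k : linpoly (delta_mx 0 k : 'rV[C]_d) = 'X_k.
Proof.
rewrite /linpoly (bigD1 k) //= big1 ?addr0.
  by rewrite mxE !eqxx scale1r.
by move=> j /negbTE njk; rewrite mxE njk andbF scale0r.
Qed.

(** A vector orthogonal to all the weights in J lies in the flat, so that the
    matrix with these weights as rows has trivial kernel. *)
Lemma flat0_span J : flat J = 0%VS ->
  forall v : 'rV[C]_d, exists a : 'I_n -> C,
    v = \sum_(j in J) a j *: toC R (xi j).
Proof.
move=> J0 v.
pose M : 'M[C]_(n, d) := \matrix_(j, k) (if j \in J then toC R (xi j) 0 k else 0).
have full : row_full M.
  rewrite -[M]trmxK /row_full mxrank_tr; change (row_free M^T).
  rewrite -kermx_eq0; apply/eqP/row_matrixP => i; rewrite row0; apply/eqP.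
  set u := row i _; suff : u \in flat J by rewrite J0 memv0.
  apply/mem_flat => j jJ.
  have : u *m M^T = 0 by rewrite -row_mul mulmx_ker row0.
  move=> /matrixP/(_ 0 j); rewrite !mxE => e; rewrite -[RHS]e.
  by apply: eq_bigr => k _; rewrite !mxE jJ mulrC.
have /submxP [D ->] : (v <= M)%MS by apply: submx_full.
exists (D 0); rewrite mulmx_sum_row [RHS]big_mkcond; apply: eq_bigr => j _.
case: ifP => jJ.
  by congr (_ *: _); apply/rowP => k; rewrite !mxE jJ.
suff -> : row j M = 0 by rewrite scaler0.
by apply/rowP => k; rewrite !mxE jJ.
Qed.

(** The directions alpha for which some (d/d alpha + c) maps the generating
    function to a quasipolynomial form a linear subspace: for a sum of two
    directions take the sum of the two constants.  Hence it suffices to know a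
    spanning family, and the constants of linearly dependent directions need
    not be compatible. *)
Lemma quasipoly_of_spanning J F : scalar F -> flat J = 0%VS ->
  (forall j, j \in J -> exists c : C,
     quasipoly (fun p => F ((linpoly (toC R (xi j)) + c%:MP) * p))) -> quasipoly F.
Proof.
move=> lF J0 qF.
pose P (al : 'rV[C]_d) := exists c : C, quasipoly (fun p => F ((linpoly al + c%:MP) * p)).
have PD al be : P al -> P be -> P (al + be).
  move=> [c qc] [e qe]; exists (c + e); apply: quasipoly_ext (quasipolyD qc qe) => p.
  by rewrite -(functionalD lF) linpolyD mpolyCD -mulrDl addrACA.
have P0 : P 0.
  exists 0; apply: quasipoly_ext (quasipoly0 R d) => p.
  by rewrite linpoly0 mpolyC0 addr0 mul0r functional0.
have PZ a al : P al -> P (a *: al).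
  move=> [c qc]; exists (a * c); apply: quasipoly_ext (quasipolyZ a qc) => p.
  by rewrite -(functionalZ lF) linpolyZ mpolyCM mul_mpolyC -scalerDr scalerAl.
have Pall al : P al.
  have [a ->] := flat0_span J0 al.
  by apply: (big_ind P P0 PD) => j jJ; apply/PZ/qF.
have [c cP] := choice (fun k => Pall (delta_mx 0 k)).
apply: (@quasipoly_of_affine_partials _ _ (\row_k c k)) => // k.
by have := cP k; rewrite linpoly_delta mxE.
Qed.

Definition factor (t : 'I_n * C) : Pol := linpoly (toC R (xi t.1)) + t.2%:MP.

Definition kills (s : seq ('I_n * C)) F :=
  forall p, F ((\prod_(t <- s) factor t) * p) = 0.

(** A finite-dimensionality statement: an operator product for each i kills the
    generating function, and any choice of one factor in each product leaves
    spanning directions.  By induction on the total number of factors, applying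
    the first factor of one product to F shortens this product, so it gives a
    quasipolynomial; the first factors of all products span. *)
Lemma quasipoly_of_kills k (fam : 'I_k -> seq ('I_n * C)) F : scalar F ->
  (forall i, kills (fam i) F) ->
  (forall J, (forall i, has (fun t => t.1 \in J) (fam i)) -> flat J = 0%VS) ->
  quasipoly F.
Proof.
have [N] := ubnP (\sum_i size (fam i)); elim: N fam F => // N IH fam F.
rewrite ltnS => leN lF kF hit.
have [/existsP [i /eqP fi0]|/existsPn ne] := boolP [exists i, fam i == [::]].
  apply: quasipoly_ext (quasipoly0 R d) => p.
  by have := kF i p; rewrite fi0 big_nil mul1r.
pose heads i j := if fam i is t :: _ then t.1 == j else false.
(* The directions of the first factors of all the products. *)
pose J := [set j | [exists i, heads i j]].
have J0 : flat J = 0%VS.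
  apply: hit => i; have := ne i; case E: (fam i) => [//|t s] _ /=.
  by apply/orP; left; rewrite inE; apply/existsP; exists i; rewrite /heads E.
apply: (quasipoly_of_spanning lF J0) => j; rewrite inE => jJ.
have := existsP jJ; case=> i; rewrite /heads.
case E: (fam i) => [//|t s] /eqP <-; exists t.2.
pose fam' i' := if i' == i then s else fam i'.
have fam'_sub i' : {subset fam' i' <= fam i'}.
  rewrite /fam'; case: eqP => [->|_] u us //.
  by rewrite E in_cons us orbT.
apply: (IH fam').
- apply: leq_trans leN; rewrite [X in (X < _)%N](bigD1 i) //= [X in (_ < X)%N](bigD1 i) //=.
  rewrite /fam' eqxx E /= addSn ltnS leq_add2l; apply: leq_sum => i' /negbTE ->.
  by [].
- by move=> a p q; rewrite mulrDr -scalerAr lF.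
- move=> i' p; rewrite /fam'; have [_|ni] := eqVneq i' i.
    by have := kF i p; rewrite E big_cons -mulrA.
  by rewrite mulrCA kF.
- move=> J' hJ'; apply: hit => i'; have /hasP [u us uJ] := hJ' i'.
  by apply/hasP; exists u => //; apply: fam'_sub.
Qed.

(** A hyperplane is the kernel of a functional with values in a line. *)
Lemma dim_cap_hyperplane (U : {vspace 'rV[C]_d}) x :
  (\dim U <= (\dim (U :&: hyperplane R x)).+1)%N.
Proof.
rewrite /hyperplane; set f := linfun _.
rewrite -(limg_ker_dim f U) -[leqRHS]addn1 leq_add2l.
by apply: leq_trans (dimvS (subvf _)) _; rewrite dimvf /dim /= muln1.
Qed.

(** Take J maximal among the sets with nonzero flat: intersecting with any
    further hyperplane gives 0, and this lowers the dimension by at most one. *)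
Lemma line_in_flat (J0 : {set 'I_n}) : flat [set: 'I_n] = 0%VS ->
  flat J0 != 0%VS -> exists2 J : {set 'I_n}, J0 \subset J & \dim (flat J) = 1%N.
Proof.
move=> T0 nz0.
pose P (J : {set 'I_n}) := (J0 \subset J) && (flat J != 0%VS).
have P0 : P J0 by rewrite /P subxx.
case: (arg_maxnP (fun J : {set 'I_n} => #|J|) P0) => J /andP [sJ nzJ] Jmax.
exists J => //; apply/eqP; rewrite eqn_leq [(0 < _)%N]lt0n dimv_eq0 nzJ andbT.
have [j jJ] : exists j, j \notin J.
  apply/existsP; apply: contraNT nzJ => /existsPn h; rewrite -T0.
  by apply/eqP; congr flat; apply/setP => j; rewrite inE; have := h j; rewrite negbK.
have : flat (j |: J) == 0%VS.
  apply: contraT => nz; have := Jmax (j |: J).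
  rewrite /P nz (fintype.subset_trans sJ) ?finset.subsetUr // => /(_ isT).
  by rewrite cardsU1 jJ add1n /= ltnn.
rewrite /flat big_setU1 //= -/(flat J) capvC -dimv_eq0 => /eqP e.
by have := dim_cap_hyperplane (flat J) (xi j); rewrite e.
Qed.

(** The rank of an integer matrix is the same over the rationals and over the
    complex numbers; then clear denominators. *)
Lemma integral_point_of_flat : flat [set: 'I_n] != 0%VS ->
  exists2 lam : 'rV[int]_d, lam != 0 & forall i, dot (xi i) lam = 0.
Proof.
pose M : 'M[rat]_(d, n) := \matrix_(k, i) (xi i 0 k)%:~R.
have [M0|nM] := eqVneq (kermx M) 0.
  have free : row_free (map_mx (ratr : rat -> C) M).
    by rewrite row_free_map -kermx_eq0 M0.
  case/negP; rewrite -subv0; apply/subvP => v /mem_flat vP.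
  rewrite memv0; apply/eqP; apply: (row_free_inj free); rewrite mul0mx.
  apply/rowP => i; rewrite !mxE; have := vP i (finset.in_setT _); rewrite /dot => e.
  rewrite -[RHS]e; apply: eq_bigr => k _.
  by rewrite !mxE mulrC ratr_int.
move=> _; have [i ui] : exists i, row i (kermx M) != 0.
  apply/existsP; apply: contraNT nM => /existsPn h; apply/eqP/row_matrixP => i.
  by rewrite row0; have := h i; rewrite negbK => /eqP.
pose u := row i (kermx M).
have [q [a a0 e]] := rat_poly_scale (rVpoly u).
have qE (k : 'I_d) : (q`_k)%:~R = a%:~R * u 0 k.
  have := coef_rVpoly_ord u k; rewrite e coefZ coef_map /= => <-.
  by rewrite mulrA mulfV ?mul1r // intr_eq0.
exists (\row_k q`_k).
  apply: contraNneq ui => q0; apply/eqP/rowP => k; rewrite [RHS]mxE.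
  have := qE k; have /rowP/(_ k) := q0; rewrite !mxE => ->.
  by move/esym/eqP; rewrite mulf_eq0 intr_eq0 (negbTE a0) /= => /eqP.
move=> j; apply: (@intr_inj rat); rewrite /dot rmorph_sum /=.
have : u *m M = 0 by rewrite -row_mul mulmx_ker row0.
move=> /rowP/(_ j); rewrite !mxE => uM.
rewrite -[RHS](mulr0 a%:~R) -[in RHS]uM mulr_sumr; apply: eq_bigr => k _.
by rewrite !mxE rmorphM /= qE !mxE mulrC mulrA.
Qed.

End Span.

(** * Shift identities satisfied by a twisted trace *)

Section Trace.
Variables (R : realType) (d n : nat).
Local Notation C := (Cx R).
Local Notation Pol := {mpoly C[d]}.
Variables (xi : 'I_n -> 'rV[int]_d).
Implicit Types (F : Pol -> C) (J : {set 'I_n}) (s : seq ('I_n * C)) (l : 'rV[int]_d).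

Lemma dotN (K : pzRingType) (u v : 'rV[K]_d) : dot u (- v) = - dot u v.
Proof. by rewrite /dot -sumrN; apply: eq_bigr => k _; rewrite mxE mulrN. Qed.

Lemma dotZ (a : C) (u v : 'rV[C]_d) : dot u (a *: v) = a * dot u v.
Proof. by rewrite /dot mulr_sumr; apply: eq_bigr => k _; rewrite mxE mulrCA. Qed.

Lemma prod_nat_rev (K : comNzRingType) (f : nat -> K) N :
  \prod_(1 <= j < N.+1) f j = \prod_(1 <= j < N.+1) f (N.+1 - j)%N.
Proof. by rewrite big_nat_rev /=; apply: eq_bigr => j _; rewrite add1n subSS. Qed.

Lemma shift_prod (I : Type) (r : seq I) (P : pred I) (f : I -> Pol) v :
  shift v (\prod_(i <- r | P i) f i) = \prod_(i <- r | P i) shift v (f i).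
Proof. by apply: (big_morph _ (shiftM v)); rewrite -mpolyC1 shiftC. Qed.

Lemma dmin_opp (a : int) : dmin a (- a) = `|a|%N.
Proof.
rewrite /dmin mulrN oppr_ge0 abszN minnn; case: ifP => // a0.
suff -> : a = 0 by [].
by apply/eqP; rewrite -sqrf_eq0 eq_le expr2 a0 -expr2 sqr_ge0.
Qed.

(** Both sides are products over the same progression of constants, traversed in
    opposite directions. *)
Lemma shift_Atilde (x l : 'rV[int]_d) (b : C) :
  shift (toC R l) (Atilde x b (- l) l) = Atilde x b l (- l).
Proof.
rewrite /Atilde !dotN; set a := dot x l.
have -> : dmin (- a) a = `|a|%N by rewrite -{2}[a]opprK dmin_opp abszN.
rewrite dmin_opp oppr_ge0 oppr_le0.
have e c : shift (toC R l) (linpoly (toC R x) + c%:MP) =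
    linpoly (toC R x) + (a%:~R + c)%:MP.
  by rewrite shiftD shift_linpoly shiftC dot_toC mpolyCD addrA.
have [a0|a0|a0] := ltgtP a 0; rewrite /= ?andbT ?andbF /=.
- rewrite shift_prod prod_nat_rev; apply: eq_big_nat => j /andP [j1 jlt].
  rewrite e; congr (_ + _%:MP).
  rewrite natrB 1?ltnW // -addn1 natrD rmorphN /=.
  have -> : a%:~R = - `|a|%N%:R :> C.
    by rewrite pmulrn abszE ltr0_norm // rmorphN opprK.
  by field.
- rewrite shift_prod prod_nat_rev; apply: eq_big_nat => j /andP [j1 jlt].
  rewrite e; congr (_ + _%:MP).
  rewrite natrB 1?ltnW // -addn1 natrD rmorphN /=.
  have -> : a%:~R = `|a|%N%:R :> C.
    by rewrite pmulrn abszE gtr0_norm.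
  by field.
- by rewrite a0 !big_nil shiftC.
Qed.

(** The linear factors that may occur in r^l r^(-l): their weight does not
    vanish at l. *)
Definition active l : pred ('I_n * C) := fun t => dot (xi t.1) l != 0.

Lemma Atilde_factors (i : 'I_n) (b : C) l : exists2 s, all (active l) s &
  Atilde (xi i) b (- l) l = \prod_(t <- s) factor xi t.
Proof.
have [z|nz] := eqVneq (dot (xi i) l) 0.
  by exists [::] => //; rewrite /Atilde dotN z oppr0 /dmin mul0r lexx !big_nil.
have P (f : nat -> C) N : exists2 s, all (active l) s &
    \prod_(1 <= j < N) (linpoly (toC R (xi i)) + (f j)%:MP) = \prod_(t <- s) factor xi t.
  exists [seq (i, f j) | j <- index_iota 1 N].
    by rewrite all_map; apply/allP => j _.
  by rewrite big_map.
rewrite /Atilde; case: ifP => _; first exact: P.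
case: ifP => _; last by exists [::]; rewrite ?big_nil.
have [s sP e] := P (fun j => b + (dot (xi i) (- l))%:~R + j%:R - 2^-1)
  (dmin (dot (xi i) (- l)) (dot (xi i) l)).+1.
by exists s.
Qed.

Lemma prod_Atilde_factors (b : 'I_n -> C) l : exists2 s, all (active l) s &
  \prod_i Atilde (xi i) (b i) (- l) l = \prod_(t <- s) factor xi t.
Proof.
apply: (big_ind (fun q : Pol => exists2 s, all (active l) s & q = \prod_(t <- s) factor xi t)).
- by exists [::]; rewrite ?big_nil.
- move=> p q [s sP ->] [t tP ->]; exists (s ++ t); first by rewrite all_cat sP.
  by rewrite big_cat.
- by move=> i _; apply: Atilde_factors.
Qed.

Lemma shift_factors (v : 'rV[C]_d) l s : all (active l) s ->
  exists2 t, all (active l) t &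
    shift v (\prod_(u <- s) factor xi u) = \prod_(u <- t) factor xi u.
Proof.
move=> sP; exists [seq (u.1, u.2 + dot (toC R (xi u.1)) v) | u <- s].
  by rewrite all_map.
rewrite shift_prod big_map; apply: eq_bigr => u _.
by rewrite /factor shiftD shift_linpoly shiftC /= mpolyCD addrAC -addrA.
Qed.

(** On generating functions, multiplication by e^(l/2) - q e^(-l/2). *)
Definition shift_diff l (q : C) F : Pol -> C :=
  fun p => F (shift (half_coweight R l) p) - q * F (shift (- half_coweight R l) p).

Lemma shift_diff_scalar l q F : scalar F -> scalar (shift_diff l q F).
Proof. by move=> lF a u v; rewrite /shift_diff !shift_linear !lF; ring. Qed.

Lemma shift_shiftC u v (p : Pol) : shift u (shift v p) = shift v (shift u p).
Proof. by rewrite !shift_shift addrC. Qed.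

Lemma shift_diffC l l' q q' F : shift_diff l q (shift_diff l' q' F) = shift_diff l' q' (shift_diff l q F).
Proof.
apply/funext => p; rewrite /shift_diff.
move: (half_coweight R l) (half_coweight R l') => h h'.
rewrite (shift_shiftC h h') (shift_shiftC h (- h')).
rewrite (shift_shiftC (- h) h') (shift_shiftC (- h) (- h')).
move: (F _) (F _) (F _) (F _) => x y z t; ring.
Qed.

(** The generating function of F is a solution of a product of first-order
    operators d/d xi_i + c, all of them with xi_i(l) nonzero. *)
Definition killed l F := exists2 s, all (active l) s & kills xi s F.

(** If Q kills F, the product of the translates of Q by half of l' and by minus
    half of l' kills both terms of the difference. *)
Lemma killed_shift_diff l l' q F : scalar F -> killed l F -> killed l (shift_diff l' q F).
Proof.
move=> lF [s sP sF]; set h := half_coweight R l'.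
have [t tP te] := shift_factors h sP; have [u uP ue] := shift_factors (- h) sP.
exists (t ++ u); first by rewrite all_cat tP.
move=> p; rewrite big_cat /= -te -ue /shift_diff -/h !shiftM !shift_shift.
rewrite subrr addNr !shift0.
rewrite [X in F X - _]mulrAC [X in F X - _]mulrC -[X in q * F X]mulrA.
by rewrite !sF mulr0 subr0.
Qed.

Section CoulombBranch.
Variables (b : 'I_n -> C) (A : algType C) (iota : {lrmorphism Pol -> A}).
Variables (r : 'rV[int]_d -> A) (hA : is_coulomb_branch xi b iota r).
Variables (zeta : 'rV[C]_d) (g : {lrmorphism A -> A}) (hg : is_twist iota r zeta g).
Variables (T : {scalar A}) (hT : is_twisted_trace g T).

Lemma iotaC c : iota c%:MP = c%:A.
Proof. by rewrite -[c%:MP]mulr1 mul_mpolyC rmorph_alg. Qed.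

(** The commutation relation with linear functions extends to all polynomials
    because shift is a ring morphism. *)
Lemma monopole_comm l p : r l * iota p = iota (shift (toC R l) p) * r l.
Proof.
elim/mpoly_ring_ind: p => [c|k|p q IHp IHq|p q IHp IHq].
- by rewrite shiftC iotaC -scalerAl -scalerAr mul1r mulr1.
- have := cb_comm hA l (delta_mx 0 k).
  rewrite linpoly_delta shift_X => /eqP; rewrite subr_eq => /eqP ->.
  rewrite /dot (bigD1 k) //= big1 ?addr0 => [|j /negbTE nj]; last first.
    by rewrite mxE nj andbF mul0r.
  rewrite mxE !eqxx mul1r rmorphD mulrDl addrC; congr (_ + _).
  by rewrite -[r l in LHS]mul1r scalerAl -iotaC.
- by rewrite shiftD !rmorphD mulrDr mulrDl IHp IHq.
- by rewrite shiftM !rmorphM mulrA IHp -mulrA IHq mulrA.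
Qed.

(** The trace identity for r^l and p r^(-l): the two products r^l r^(-l) and
    r^(-l) r^l are polynomials, and they differ by a translation. *)
Lemma trace_shift l p :
  let Q := \prod_i Atilde (xi i) (b i) (- l) l in
  T (iota (shift (toC R l) (p * Q))) = twist_factor zeta l * T (iota (p * Q)).
Proof.
move=> Q; have [_ gr _] := hg.
have := hT (r l) (iota p * r (- l)).
rewrite gr -scalerAr linearZ /= => e.
transitivity (T (r l * (iota p * r (- l)))).
  rewrite mulrA monopole_comm -mulrA (cb_mul hA) subrr (cb_r0 hA) mulr1.
  rewrite -rmorphM shiftM /Q shift_prod; congr (T (iota (_ * _))).
  by apply: eq_bigr => i _; rewrite shift_Atilde.
by rewrite e -mulrA (cb_mul hA) addNr (cb_r0 hA) mulr1 -rmorphM.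
Qed.

Let T0 : Pol -> C := T \o iota.

Lemma T0_scalar : scalar T0.
Proof. by move=> a p q; rewrite /T0 /= !linearP. Qed.

(** This is the identity of trace_shift, with p recentred so that the translation
    by l is split into two halves. *)
Lemma killed_trace l : killed l (shift_diff l (twist_factor zeta l) T0).
Proof.
have [s sP se] := prod_Atilde_factors b l.
set h := half_coweight R l.
have hh : h + h = toC R l.
  rewrite /h /half_coweight -scalerDl.
  have -> : 2^-1 + 2^-1 = 1 :> C by field.
  by rewrite scale1r.
have [t tP te] := shift_factors h sP.
exists t => // p; rewrite /shift_diff -/h -te -se !shiftM !shift_shift hh addNr shift0.
apply/eqP; rewrite subr_eq0; apply/eqP.
have := trace_shift l (shift (- h) p); rewrite /= [_ * \prod_i _]mulrC => <-.
by rewrite shiftM shift_shift -hh addrK.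
Qed.

(** On generating functions, multiplication by the whole denominator. *)
Definition shift_diffs (I : eqType) (L : seq I) (lam : I -> 'rV[int]_d) F :=
  foldr (fun i G => shift_diff (lam i) (twist_factor zeta (lam i)) G) F L.

Lemma shift_diffs_scalar (I : eqType) (L : seq I) (lam : I -> 'rV[int]_d) F :
  scalar F -> scalar (shift_diffs L lam F).
Proof. by move=> lF; elim: L => //= i L IH; apply: shift_diff_scalar. Qed.

Lemma killed_shift_diffs (I : eqType) (L : seq I) (lam : I -> 'rV[int]_d) i :
  i \in L -> killed (lam i) (shift_diffs L lam T0).
Proof.
have pres F l L' : scalar F -> killed l F -> killed l (shift_diffs L' lam F).
  move=> lF kF; elim: L' => //= j L' IH.
  by apply: killed_shift_diff => //; apply: shift_diffs_scalar.
have comm F j L' q : shift_diffs L' lam (shift_diff (lam j) q F) = shift_diff (lam j) q (shift_diffs L' lam F).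
  by elim: L' => [//|k L' IH] /=; rewrite IH; apply: shift_diffC.
elim: L => // j L IH; rewrite in_cons => /orP [/eqP ->|iL] /=.
  rewrite -comm; apply: pres; first exact/shift_diff_scalar/T0_scalar.
  exact: killed_trace.
by apply: killed_shift_diff; [apply/shift_diffs_scalar/T0_scalar | apply: IH].
Qed.

(** Choose for each line l in L the operator product attached to l.  If some
    choice of factors did not span, their flat would contain a line l of the
    arrangement; but the factor chosen for l has a weight that does not vanish
    on l. *)
Lemma quasipoly_shift_diffs (lam : {vspace 'rV[C]_d} -> 'rV[int]_d) :
  flat R xi [set: 'I_n] = 0%VS ->
  (forall W, W \in lines R xi -> is_shortest W (lam W)) ->
  quasipoly (shift_diffs (lines R xi) lam T0).
Proof.
move=> flatT hlam; set L := lines R xi.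
have hk (i : 'I_(size L)) : exists s : seq ('I_n * C),
    all (active (lam (nth 0%VS L i))) s /\ kills xi s (shift_diffs L lam T0).
  have [s s1 s2] := killed_shift_diffs lam (mem_nth 0%VS (ltn_ord i)).
  by exists s.
have [fam famP] := choice hk.
apply: (quasipoly_of_kills (xi := xi) (fam := fam)).
- exact/shift_diffs_scalar/T0_scalar.
- by move=> i; have [] := famP i.
move=> J hit; apply/eqP; apply: contraT => nzJ.
have [J' sJ dim1] := line_in_flat flatT nzJ.
have lJ' : flat R xi J' \in L.
  rewrite /L /lines mem_undup mem_filter dim1 eqxx /=.
  by apply/mapP; exists J'; rewrite ?mem_enum.
have lt : (index (flat R xi J') L < size L)%N by rewrite index_mem.
have /hasP [t tf tJ] := hit (Ordinal lt).
have [/allP/(_ _ tf)] := famP (Ordinal lt).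
rewrite /= nth_index // /active => /negP []; apply/eqP/(@intr_inj C).
have [_ + _] := hlam _ lJ'.
by move=> /mem_flat /(_ t.1 (fintype.subsetP sJ _ tJ)); rewrite dot_toC => ->.
Qed.

(** No factor is active at l, so the empty product kills the difference. *)
Lemma shift_diff_trace_eq0 l : (forall i, dot (xi i) l = 0) ->
  shift_diff l (twist_factor zeta l) T0 = fun=> 0.
Proof.
move=> h; have [s sP sF] := killed_trace l; apply: funext => p.
have s0 : s = [::].
  by case: s sP {sF} => //= t s /andP []; rewrite /active h eqxx.
by have := sF p; rewrite s0 big_nil mul1r.
Qed.

End CoulombBranch.
End Trace.

(** * Formal power series and generating functions *)

Section FpsRing.
Variables (R : realType) (d : nat).
Local Notation C := (Cx R).
Local Notation Pol := {mpoly C[d]}.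
Local Notation fps := (fps R d).
Implicit Types (F G H : fps) (m : 'X_{1..d}) (p q : Pol).

(** A coefficient of a product depends on finitely many coefficients of the
    factors, so that identities between power series are read off from
    polynomials. *)
Definition trunc N F : Pol := \sum_(m : 'X_{1..d < N}) F m *: 'X_[m].

Lemma mcoeff_trunc N F m : (mdeg m < N)%N -> (trunc N F)@_m = F m.
Proof. exact: mcoeff_mpoly. Qed.

Lemma mcoeffM_congr p q p' q' m :
  (forall k, (mdeg k <= mdeg m)%N -> p@_k = p'@_k) ->
  (forall k, (mdeg k <= mdeg m)%N -> q@_k = q'@_k) ->
  (p * q)@_m = (p' * q')@_m.
Proof.
move=> ep eq; rewrite !mcoeffM; apply: eq_bigr => k _.
by rewrite ep ?eq // -ltnS bmdeg.
Qed.

Lemma fps_mulE N F G m : (mdeg m < N)%N ->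
  fps_mul F G m = (trunc N F * trunc N G)@_m.
Proof.
move=> lt; rewrite mcoeffM; apply: eq_bigr => k _.
by rewrite !mcoeff_trunc // (leq_trans (bmdeg _) lt).
Qed.

Lemma fps_mulC : commutative (@fps_mul R d).
Proof.
move=> F G; apply/funext => m.
by rewrite !(fps_mulE _ _ (ltnSn _)) mulrC.
Qed.

Lemma fps_mulA : associative (@fps_mul R d).
Proof.
move=> F G H; apply/funext => m; set N := (mdeg m).+1.
have e F' G' k : (mdeg k <= mdeg m)%N ->
    (trunc N (fps_mul F' G'))@_k = (trunc N F' * trunc N G')@_k.
  by move=> lek; rewrite mcoeff_trunc // (@fps_mulE N).
rewrite (fps_mulE _ (fps_mul G H) (ltnSn _)) (fps_mulE (fps_mul F G) _ (ltnSn _)) -/N.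
rewrite (@mcoeffM_congr _ _ (trunc N F) (trunc N G * trunc N H)) //; last exact: e.
rewrite [RHS](@mcoeffM_congr _ _ (trunc N F * trunc N G) (trunc N H)) //; last exact: e.
by rewrite mulrA.
Qed.

Lemma fps_mul1 : left_id (@fps_one R d) (@fps_mul R d).
Proof.
move=> F; apply/funext => m; rewrite (fps_mulE _ _ (ltnSn _)).
rewrite (@mcoeffM_congr _ _ 1 (trunc (mdeg m).+1 F)) //.
  by rewrite mul1r mcoeff_trunc.
by move=> k lek; rewrite mcoeff_trunc // mcoeff1.
Qed.

HB.instance Definition _ :=
  Monoid.isComLaw.Build fps (@fps_one R d) (@fps_mul R d) fps_mulA fps_mulC fps_mul1.

Lemma fps_mulDr F G H :
  fps_mul F (fun m => G m + H m) = fun m => fps_mul F G m + fps_mul F H m.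
Proof.
apply/funext => m; rewrite /fps_mul -big_split; apply: eq_bigr => k _.
by rewrite mulrDr.
Qed.

Lemma fps_mulZr a F G :
  fps_mul F (fun m => a * G m) = fun m => a * fps_mul F G m.
Proof.
apply/funext => m; rewrite /fps_mul mulr_sumr; apply: eq_bigr => k _.
by rewrite mulrCA.
Qed.

Lemma fps_mulDl F G H :
  fps_mul (fun m => G m + H m) F = fun m => fps_mul G F m + fps_mul H F m.
Proof. by rewrite fps_mulC fps_mulDr !(fps_mulC F). Qed.

Lemma fps_mulZl a F G :
  fps_mul (fun m => a * G m) F = fun m => a * fps_mul G F m.
Proof. by rewrite fps_mulC fps_mulZr (fps_mulC F). Qed.

Definition deriv_fps k F : fps := fun m => F (m + U_(k))%MM *+ (m k).+1.

Lemma deriv_fpsM k F G m : deriv_fps k (fps_mul F G) m =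
  fps_mul (deriv_fps k F) G m + fps_mul F (deriv_fps k G) m.
Proof.
have degU l : mdeg (l + U_(k)) = (mdeg l).+1 by rewrite mdegD mdeg1 addn1.
rewrite /deriv_fps (@fps_mulE (mdeg m).+2) ?degU // -mcoeff_deriv mderivM mcoeffD.
have e H l : (mdeg l <= mdeg m)%N ->
    ((trunc (mdeg m).+2 H)^`M(k))@_l = (trunc (mdeg m).+1 (deriv_fps k H))@_l.
  by move=> lel; rewrite mcoeff_deriv !mcoeff_trunc // degU.
congr (_ + _); rewrite (fps_mulE _ _ (ltnSn _)); apply: mcoeffM_congr => l lel.
- exact: e.
- by rewrite !mcoeff_trunc // ltnS (leq_trans lel).
- by rewrite !mcoeff_trunc // ltnS (leq_trans lel).
- exact: e.
Qed.

Lemma fps_mul_polyX m0 F m : fps_mul (fps_poly 'X_[m0]) F m =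
  if (m0 <= m)%MM then F (m - m0)%MM else 0.
Proof.
rewrite (fps_mulE _ _ (ltnSn _)).
rewrite (@mcoeffM_congr _ _ 'X_[m0] (trunc (mdeg m).+1 F)) //; last first.
  by move=> k lek; rewrite mcoeff_trunc.
rewrite mulrC; case: ifPn => lem.
  rewrite -{1}(submK lem) addmC mcoeffMX mcoeff_trunc //.
  by rewrite ltnS mdegB.
apply/eqP; rewrite mcoeff_eq0 (perm_mem (msuppMX _ _)); apply: contra lem.
by move=> /mapP [m' _ ->]; apply/mnm_lepP => k; rewrite mnmDE leq_addr.
Qed.

End FpsRing.

Section GeneratingFunction.
Variables (R : realType) (d : nat).
Local Notation C := (Cx R).
Local Notation Pol := {mpoly C[d]}.
Implicit Types (F G : Pol -> C) (m : 'X_{1..d}) (mu : 'rV[C]_d).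

Definition genfun F : fps R d := fun m => F 'X_[m] / (mfact m)%:R.

Lemma mfact_neq0 m : (mfact m)%:R != 0 :> C.
Proof.
rewrite pnatr_eq0 -lt0n; apply: prodn_gt0 => k; exact: fact_gt0.
Qed.

Lemma mfactS k m : mfact (U_(k) + m) = ((m k).+1 * mfact m)%N.
Proof.
rewrite /mfact (bigD1 k) //= [in RHS](bigD1 k) //= mulnA mnmDE mnm1E eqxx add1n factS.
congr (_ * _)%N; apply: eq_bigr => j /negbTE njk.
by rewrite mnmDE mnm1E eq_sym njk.
Qed.

Lemma deriv_genfun k F : deriv_fps k (genfun F) = genfun (fun p => F ('X_k * p)).
Proof.
apply/funext => m; rewrite /deriv_fps /genfun [(m + _)%MM]addmC mfactS mpolyXD.
by rewrite -[LHS]mulr_natr natrM -mulrA invfM [_^-1 * _ * _]mulrAC mulVf ?mul1r // pnatr_eq0.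
Qed.

Lemma deriv_exp k mu m : deriv_fps k (fps_exp mu) m = mu 0 k * fps_exp mu m.
Proof.
rewrite /deriv_fps /fps_exp [(m + _)%MM]addmC mfactS.
have -> : \prod_j mu 0 j ^+ (U_(k) + m)%MM j = mu 0 k * \prod_j mu 0 j ^+ m j.
  rewrite (bigD1 k) //= [in RHS](bigD1 k) //= mulrA mnmDE mnm1E eqxx add1n exprS.
  congr (_ * _); apply: eq_bigr => j /negbTE njk.
  by rewrite mnmDE mnm1E eq_sym njk.
by rewrite -[LHS]mulr_natr natrM -mulrA invfM [_^-1 * _ * _]mulrAC mulVf ?mul1r ?mulrA // pnatr_eq0.
Qed.

Lemma deriv_fps_inj k (F G : fps R d) m :
  deriv_fps k F m = deriv_fps k G m -> F (U_(k) + m)%MM = G (U_(k) + m)%MM.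
Proof.
rewrite /deriv_fps addmC -(mulr_natr (F _)) -(mulr_natr (G _)).
by move=> /mulIf; apply; rewrite pnatr_eq0.
Qed.

Lemma fps_mul0 (F G : fps R d) : fps_mul F G 0%MM = F 0%MM * G 0%MM.
Proof.
rewrite (@fps_mulE _ _ 1) ?mdeg0 // mcoeff0_is_multiplicative.
by rewrite !mcoeff_trunc ?mdeg0.
Qed.

Lemma fps_exp0 mu : fps_exp mu 0%MM = 1.
Proof.
rewrite /fps_exp /mfact !big1 ?divr1 // => k _; first by rewrite mnm0E.
by rewrite mnm0E expr0.
Qed.

(** Both sides take the value F 1 at 0 and have the same derivatives: along y_k
    one gets the two sides for the functionals F(X_k p) and mu_k F(p). *)
Lemma genfun_shift mu F : scalar F ->
  genfun (F \o @shift R d mu) = fps_mul (fps_exp mu) (genfun F).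
Proof.
move=> lF; apply/funext => m; elim/mnm_ind: m F lF => [|k m IH] F lF.
  rewrite fps_mul0 fps_exp0 mul1r /genfun /= mpolyX0 -mpolyC1 shiftC.
  by [].
have lX : scalar (fun p => F ('X_k * p)).
  by move=> a p q; rewrite mulrDr -scalerAr lF.
apply: deriv_fps_inj.
rewrite deriv_fpsM deriv_genfun.
have -> : genfun (fun p => (F \o @shift R d mu) ('X_k * p)) m =
    genfun ((fun p => F ('X_k * p)) \o @shift R d mu) m + mu 0 k * genfun (F \o @shift R d mu) m.
  rewrite /genfun /= shiftM shift_X mulrDl mul_mpolyC (functionalD lF) (functionalZ lF).
  by rewrite mulrDl mulrA.
rewrite !IH // deriv_genfun addrC; congr (_ + _).
have -> : deriv_fps k (fps_exp mu) = fun l => mu 0 k * fps_exp mu l.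
  by apply/funext => l; rewrite deriv_exp.
by rewrite fps_mulZl.
Qed.

(** A factor e^(l/2) - q e^(-l/2) of the denominator; for q = 1 it is
    2 sinh(l/2). *)
Definition sinh_fps (q : C) (l : 'rV[int]_d) : fps R d := fun m =>
  fps_exp (half_coweight R l) m - q * fps_exp (- half_coweight R l) m.

Lemma genfun_shift_diff l q F : scalar F ->
  genfun (shift_diff l q F) = fps_mul (sinh_fps q l) (genfun F).
Proof.
move=> lF; rewrite /sinh_fps; set h := half_coweight R l.
have -> : (fun m => fps_exp h m - q * fps_exp (- h) m) =
    (fun m => fps_exp h m + (- q) * fps_exp (- h) m).
  by apply/funext => m; rewrite mulNr.
rewrite fps_mulDl fps_mulZl -!genfun_shift //; apply/funext => m.
by rewrite /genfun /shift_diff /= mulrBl mulNr mulrA.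
Qed.

Lemma genfun_shift_diffs zeta (L : seq {vspace 'rV[C]_d}) lam F : scalar F ->
  genfun (shift_diffs zeta L lam F) = fps_mul (fps_den zeta L lam) (genfun F).
Proof.
move=> lF; elim: L => [|l L IH]; rewrite /fps_den.
  by rewrite big_nil fps_mul1.
rewrite big_cons /= genfun_shift_diff ?IH; last exact: shift_diffs_scalar.
by rewrite fps_mulA.
Qed.

Lemma genfun_diff_at mu m0 :
  genfun (@diff_at R d mu m0) = fps_mul (fps_poly 'X_[m0]) (fps_exp mu).
Proof.
apply/funext => m; rewrite fps_mul_polyX /genfun /diff_at mderivmX mevalZ mevalX.
case: ifPn => [/mnm_lepP lem|nle].
  have e : (mfact m = \prod_k (m k)^_(m0 k) * mfact (m - m0))%N.
    rewrite /mfact -big_split /=; apply: eq_bigr => k _.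
    by rewrite mnmBE ffact_fact.
  have := mfact_neq0 m; rewrite /fps_exp e natrM mulf_eq0 negb_or => /andP [nz _].
  by rewrite invfM mulrACA mulfV // mul1r.
have /existsP [k nlek] : [exists k, ~~ (m0 k <= m k)%N].
  by rewrite -negb_forall; apply: contra nle => /forallP h; apply/mnm_lepP.
by rewrite (bigD1 k) //= ffact_small ?mul0n ?mul0r // ltnNge.
Qed.

Lemma fps_mul_suml (I : Type) (r : seq I) (P : pred I) (f : I -> fps R d) (G : fps R d) m :
  fps_mul (fun m => \sum_(i <- r | P i) f i m) G m = \sum_(i <- r | P i) fps_mul (f i) G m.
Proof.
rewrite /fps_mul exchange_big; apply: eq_bigr => k _.
by rewrite mulr_suml.
Qed.

(** Terms with the same exponent mu are collected into one polynomial S_mu. *)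
Lemma quasipoly_fps_num F : quasipoly F ->
  exists M (S : 'rV[C]_d -> Pol), uniq M /\ genfun F = fps_num M S.
Proof.
move=> [s sP]; exists (undup [seq t.1.2 | t <- s]).
exists (fun mu => \sum_(t <- s | t.1.2 == mu) t.1.1 *: 'X_[t.2]).
split; first exact: undup_uniq.
apply/funext => m; rewrite /fps_num /genfun sP mulr_suml.
transitivity (\sum_(mu <- undup [seq t.1.2 | t <- s]) \sum_(t <- s | t.1.2 == mu)
    t.1.1 * fps_mul (fps_poly 'X_[t.2]) (fps_exp mu) m).
  rewrite (exchange_big_dep xpredT) //= big_seq [RHS]big_seq.
  apply: eq_bigr => t ts; rewrite -big_filter.
  have -> : [seq mu <- undup [seq t.1.2 | t <- s] | t.1.2 == mu] = [:: t.1.2].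
    rewrite (eq_filter (a2 := pred1 t.1.2)) => [|mu]; last by rewrite /= eq_sym.
    rewrite filter_pred1_uniq ?undup_uniq // mem_undup.
    by apply/mapP; exists t.
  by rewrite big_seq1 -genfun_diff_at /genfun mulrA.
apply: eq_bigr => mu _.
have -> : fps_poly (\sum_(t <- s | t.1.2 == mu) t.1.1 *: 'X_[t.2]) =
    (fun m => \sum_(t <- s | t.1.2 == mu) t.1.1 * ('X_[t.2] : Pol)@_m).
  apply/funext => l; rewrite /fps_poly raddf_sum.
  by apply: eq_bigr => t _; apply: mcoeffZ.
by rewrite fps_mul_suml; apply: eq_bigr => t _; rewrite fps_mulZl.
Qed.

End GeneratingFunction.

(** * Complex sequences and absolutely summable families *)

Section ComplexLimits.
Local Open Scope classical_set_scope.
Variable R : realType.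
Local Notation C := (Cx R).

Definition cofR (x : R) : C := (x%:C)%C.

Lemma norm_cofR (x : R) : `|cofR x| = cofR `|x|.
Proof. by rewrite /cofR normc_def /= expr0n addr0 sqrtr_sqr. Qed.

Lemma cofR_Re (z : C) : z \is Num.real -> z = cofR (complex.Re z).
Proof. by move=> zr; rewrite /cofR RRe_real. Qed.

Lemma cvg_cofR (u : nat -> R) (l : R) :
  u @ \oo --> l -> (fun n => cofR (u n)) @ \oo --> cofR l.
Proof.
move=> ul; apply/cvgrPdist_lt => e e0.
have eE := cofR_Re (gtr0_real e0).
have re0 : 0 < complex.Re e by move: e0; rewrite ltcE => /andP [].
move/cvgrPdist_lt: ul => /(_ _ re0); apply: filterS => n ltn.
have -> : cofR l - cofR (u n) = cofR (l - u n) by rewrite /cofR rmorphB.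
by rewrite norm_cofR [ltRHS]eE /cofR ltcR.
Qed.

Lemma cvg_complex (u : nat -> C) (a b : R) :
  (fun n => complex.Re (u n)) @ \oo --> a ->
  (fun n => complex.Im (u n)) @ \oo --> b -> u @ \oo --> ((a +i* b)%C : C).
Proof.
move=> ua ub.
have -> : u = (fun n => cofR (complex.Re (u n)) + 'i%C * cofR (complex.Im (u n))).
  by apply/funext => n; rewrite /cofR -complexE.
have -> : (a +i* b)%C = cofR a + 'i%C * cofR b :> C by rewrite [LHS]complexE.
by apply: cvgD; [|apply: cvgM; [exact: cvg_cst|]]; apply: cvg_cofR.
Qed.

Lemma cvgC_add (u v : nat -> C) (a b : C) :
  u @ \oo --> a -> v @ \oo --> b -> (fun n => u n + v n) @ \oo --> a + b.
Proof. exact: cvgD. Qed.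

Lemma cvgC_sub (u v : nat -> C) (a b : C) :
  u @ \oo --> a -> v @ \oo --> b -> (fun n => u n - v n) @ \oo --> a - b.
Proof. exact: cvgB. Qed.

Lemma cvgC_mul (u v : nat -> C) (a b : C) :
  u @ \oo --> a -> v @ \oo --> b -> (fun n => u n * v n) @ \oo --> a * b.
Proof. exact: cvgM. Qed.

(** The order of complex numbers only compares numbers with equal imaginary
    parts, so that a sequence of nonnegative numbers is a real sequence. *)
Lemma cvg_nondecreasing (u : nat -> C) (B : C) : (forall n, 0 <= u n) ->
  (forall m n, (m <= n)%N -> u m <= u n) -> (forall n, u n <= B) ->
  exists l : C, u @ \oo --> l.
Proof.
move=> u0 u_nd uB; pose v n := complex.Re (u n).
have uE n : u n = cofR (v n) by apply: cofR_Re; apply: ger0_real.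
have : cvgn v.
  apply: nondecreasing_is_cvgn.
    by move=> m n mn; have := u_nd _ _ mn; rewrite !uE /cofR lecR.
  exists (complex.Re B) => _ [n _ <-].
  by have := uB n; rewrite lecE => /andP [].
move=> /cvg_ex [l vl]; exists (cofR l).
by rewrite (_ : u = fun n => cofR (v n)) ?funeqE //; apply: cvg_cofR.
Qed.

End ComplexLimits.

Section SummableFamilies.
Local Open Scope classical_set_scope.
Variables (R : realType) (d : nat).
Local Notation C := (Cx R).
Implicit Types (a b c : fps R d) (l : C) (m : 'X_{1..d}).

Definition psum a N : C := \sum_(m : 'X_{1..d < N}) a m.
Definition fabs a : fps R d := fun m => `|a m|.
(** Absolute summability along total degree, with sum l.  The norm partial sums
    are bounded by a complex number, as the norm is complex valued. *)
Definition sums_to a l := (exists B, forall N, psum (fabs a) N <= B) /\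
  psum a @ \oo --> l.

Lemma psum_widen a N M : (N <= M)%N ->
  psum a N = \sum_(m : 'X_{1..d < M} | (mdeg m < N)%N) a m.
Proof.
move=> leNM; pose I : subFinType _ := 'X_{1..d < N}.
pose J : subFinType _ := 'X_{1..d < M}.
by rewrite /psum (big_sub_widen I J xpredT) //= => x /leq_trans; apply.
Qed.

Lemma psum_ge0 a N : (forall m, 0 <= a m) -> 0 <= psum a N.
Proof. by move=> a0; apply: sumr_ge0. Qed.

Lemma psum_le a N M : (forall m, 0 <= a m) -> (N <= M)%N -> psum a N <= psum a M.
Proof.
move=> a0 leNM; rewrite (psum_widen _ leNM) /psum [leRHS](bigID (fun m : 'X_{1..d < M} => (mdeg m < N)%N)) /=.
by rewrite lerDl; apply: sumr_ge0.
Qed.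

Lemma fabs_ge0 a m : 0 <= fabs a m.
Proof. exact: normr_ge0. Qed.

Lemma psum_single a m0 N : (forall m, m != m0 -> a m = 0) ->
  psum a N = if (mdeg m0 < N)%N then a m0 else 0.
Proof.
move=> a0; case: ifPn => lt.
  rewrite /psum (bigD1 (BMultinom lt)) //= big1 ?addr0 // => m nm.
  by apply: a0; apply: contra nm => /eqP e; apply/eqP/val_inj.
rewrite /psum big1 // => m _; apply: a0; apply: contra lt => /eqP <-.
exact: bmdeg.
Qed.

Lemma sums_single a m0 : (forall m, m != m0 -> a m = 0) -> sums_to a (a m0).
Proof.
move=> a0; split.
  exists `|a m0| => N; rewrite (psum_single (m0 := m0)) ?/fabs.
    by case: ifP.
  by move=> m /a0 ->; rewrite normr0.
apply: (@cvg_near_cst nat C); exists (mdeg m0).+1 => // N /= lt.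
by rewrite (psum_single _ a0) lt.
Qed.

Lemma sumsD a b l l' : sums_to a l -> sums_to b l' -> sums_to (fun m => a m + b m) (l + l').
Proof.
move=> [[A AP] al] [[B BP] bl]; split.
  exists (A + B) => N; apply: le_trans (lerD (AP N) (BP N)).
  by rewrite /psum -big_split; apply: ler_sum => m _; apply: ler_normD.
have -> : psum (fun m => a m + b m) = (fun N => psum a N + psum b N).
  by apply/funext => N; apply: big_split.
exact: cvgC_add.
Qed.

Lemma psumM a b N : psum a N * psum b N =
  \sum_(k : 'X_{1..d < N, N}) a k.1 * b k.2.
Proof.
rewrite /psum big_distrlr /= pair_bigA; apply: eq_bigr => k _.
by [].
Qed.

Lemma psum_fps_mul a b N : psum (fps_mul a b) N =
  \sum_(k : 'X_{1..d < N, N} | (mdeg (k.1 + k.2) < N)%N) a k.1 * b k.2.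
Proof.
have e (m : 'X_{1..d < N}) : fps_mul a b m =
    \sum_(k : 'X_{1..d < N, N} | (m == k.1 + k.2 :> 'X_{1..d})%MM) a k.1 * b k.2.
  rewrite (fps_mulE _ _ (bmdeg m)).
  rewrite (_ : (_ * _)@_m = \sum_(k : 'X_{1..d < N, N} | (m == k.1 + k.2 :> 'X_{1..d})%MM)
     (trunc N a)@_k.1 * (trunc N b)@_k.2); last exact: mcoeff_poly_mul (bmdeg m).
  by apply: eq_bigr => k _; rewrite !mcoeff_trunc ?bmdeg.
transitivity (\sum_(m : 'X_{1..d < N}) \sum_(k : 'X_{1..d < N, N} |
    (m == k.1 + k.2 :> 'X_{1..d})%MM) a k.1 * b k.2).
  by apply: eq_bigr => m _; apply: e.
rewrite (exchange_big_dep xpredT) //=.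
rewrite [RHS]big_mkcond; apply: eq_bigr => k _; case: ifPn => lt.
  rewrite (big_pred1 (BMultinom lt)) //.
rewrite big1 // => m /eqP e'; move: lt; rewrite -e' => /negP [].
exact: bmdeg.
Qed.

Lemma psumM_sub a b N : psum a N * psum b N - psum (fps_mul a b) N =
  \sum_(k : 'X_{1..d < N, N} | ~~ (mdeg (k.1 + k.2) < N)%N) a k.1 * b k.2.
Proof.
rewrite psumM psum_fps_mul [X in X - _](bigID (fun k : 'X_{1..d < N, N} => (mdeg (k.1 + k.2) < N)%N)) /=.
by rewrite addrAC subrr add0r.
Qed.

(** Two indices of degree less than N add up to one of degree less than 2N. *)
Lemma psumM_le a b N : (forall m, 0 <= a m) -> (forall m, 0 <= b m) ->
  psum a N * psum b N <= psum (fps_mul a b) (N + N).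
Proof.
move=> a0 b0.
have e c : psum c N = psum (fun m => if (mdeg m < N)%N then c m else 0) (N + N).
  by rewrite (psum_widen _ (leq_addr N N)) big_mkcond.
rewrite (e a) (e b) psumM psum_fps_mul [leRHS]big_mkcond /=.
apply: ler_sum => k _.
case: (ltnP (mdeg k.1) N) => k1; last first.
  by rewrite mul0r; case: ifP => // _; apply: mulr_ge0.
case: (ltnP (mdeg k.2) N) => k2; last first.
  by rewrite mulr0; case: ifP => // _; apply: mulr_ge0.
rewrite (_ : (mdeg (k.1 + k.2) < N + N)%N) // mdegD.
by rewrite -addnS leq_add // ltnW.
Qed.

(** Let c be the product of the two families of norms.  The error between the
    product of the partial sums of a and b at N and the partial sum of their
    product is at most the same error for the norms, hence at most the
    difference of the partial sums of c at 2N and at N, which tends to 0. *)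
Lemma sumsM a b l l' : sums_to a l -> sums_to b l' -> sums_to (fps_mul a b) (l * l').
Proof.
move=> [[A AP] al] [[B BP] bl].
pose c := fps_mul (fabs a) (fabs b).
have c0 m : 0 <= c m by apply: sumr_ge0 => k _; apply: mulr_ge0; apply: normr_ge0.
have cB N : psum c N <= A * B.
  apply: (@le_trans _ _ (psum (fabs a) N * psum (fabs b) N)).
    rewrite -subr_ge0 psumM_sub; apply: sumr_ge0 => k _.
    by apply: mulr_ge0; apply: normr_ge0.
  by apply: ler_pM => //; apply: psum_ge0; apply: fabs_ge0.
split.
  exists (A * B) => N; apply: le_trans (cB N); apply: ler_sum => m _.
  apply: le_trans (ler_norm_sum _ _ _) _; apply: ler_sum => k _.
  by rewrite normrM.
have [L cL] : exists L : C, psum c @ \oo --> L.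
  apply: (cvg_nondecreasing (B := A * B)) => // [N|m n]; first exact: psum_ge0.
  exact: psum_le.
have cL2 : (fun N => psum c (N + N)%N) @ \oo --> L.
  apply: cvg_comp cL => P [n _ nP]; exists n => // N /= nN.
  by apply: nP; rewrite /= (leq_trans nN) // leq_addr.
have lim0 : (fun N => psum c (N + N)%N - psum c N) @ \oo --> (0 : C).
  by rewrite -(subrr L); apply: cvgC_sub.
have {lim0} : (fun N => psum a N * psum b N - psum (fps_mul a b) N) @ \oo --> (0 : C).
  apply/cvgrPdist_lt => e e0; move/cvgrPdist_lt: lim0 => /(_ e e0).
  apply: filterS => N; rewrite !sub0r !normrN; apply: le_lt_trans.
  rewrite psumM_sub [leRHS]ger0_norm ?subr_ge0 ?psum_le ?leq_addr //.
  apply: (@le_trans _ _ (psum (fabs a) N * psum (fabs b) N - psum c N)); last first.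
    by rewrite lerD2r; apply: psumM_le; apply: fabs_ge0.
  rewrite psumM_sub; apply: le_trans (ler_norm_sum _ _ _) _.
  by apply: ler_sum => k _; rewrite normrM.
move=> /(cvgC_sub (cvgC_mul al bl)); rewrite subr0.
set f := (X in X @ \oo --> _ -> _); suff -> : psum (fps_mul a b) = f by [].
by apply/funext => N; rewrite /f opprB addrC subrK.
Qed.

End SummableFamilies.

(** * Evaluation of power series; the exponential series *)

Section Evaluation.
Local Open Scope classical_set_scope.
Variables (R : realType) (d : nat).
Local Notation C := (Cx R).
Local Notation Pol := {mpoly C[d]}.
Implicit Types (F G : fps R d) (z w mu nu : 'rV[C]_d) (l : C) (m : 'X_{1..d}).

(** A real family r is the difference of the nonnegative families |r| + r and
    |r|. *)
Lemma cvg_real_family (B : C) (a : fps R d) (r : 'X_{1..d} -> R) :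
  (forall N, psum (fabs a) N <= B) -> (forall m, cofR `|r m| <= `|a m|) ->
  exists l : C, psum (fun m => cofR (r m)) @ \oo --> l.
Proof.
move=> aB ra.
pose q : fps R d := fun m => cofR `|r m|.
pose p : fps R d := fun m => cofR (`|r m| + r m).
have q0 m : 0 <= q m by rewrite /q /cofR ler0c.
have p0 m : 0 <= p m by rewrite /p /cofR ler0c -lerBlDr sub0r -normrN ler_norm.
have qB N : psum q N <= B by apply: le_trans (aB N); apply: ler_sum => m _; apply: ra.
have pB N : psum p N <= B + B.
  apply: le_trans (lerD (qB N) (qB N)); rewrite /psum -big_split /=.
  by apply: ler_sum => m _; rewrite /p /q /cofR -rmorphD lecR lerD2l ler_norm.
have [lq lqP] : exists l : C, psum q @ \oo --> l.
  by apply: (cvg_nondecreasing (B := B)) => [N|m n|//]; [apply: psum_ge0|apply: psum_le].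
have [lp lpP] : exists l : C, psum p @ \oo --> l.
  by apply: (cvg_nondecreasing (B := B + B)) => [N|m n|//]; [apply: psum_ge0|apply: psum_le].
exists (lp - lq).
have -> : psum (fun m => cofR (r m)) = (fun N => psum p N - psum q N).
  apply/funext => N; rewrite /psum -sumrB; apply: eq_bigr => m _.
  by rewrite /p /q /cofR -rmorphB /= addrC addrA addNr add0r.
exact: cvgC_sub.
Qed.

Lemma abs_sums (a : fps R d) (B : C) :
  (forall N, psum (fabs a) N <= B) -> exists l, sums_to a l.
Proof.
move=> aB.
have [x xP] : exists l : C, psum (fun m => cofR (complex.Re (a m))) @ \oo --> l.
  by apply: (cvg_real_family aB) => m; rewrite /cofR normc_ge_Re.
have [y yP] : exists l : C, psum (fun m => cofR (complex.Im (a m))) @ \oo --> l.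
  apply: (cvg_real_family aB) => m; rewrite /cofR.
  have := normc_ge_Re (a m * 'i%C); rewrite ReiNIm normrN normrM.
  by rewrite [X in _ * X]normc_def /= expr0n expr1n add0r sqrtr1 mulr1.
exists (x + 'i%C * y); split; first by exists B.
have -> : psum a = (fun N => psum (fun m => cofR (complex.Re (a m))) N +
    (fun=> 'i%C) N * psum (fun m => cofR (complex.Im (a m))) N).
  apply/funext => N; rewrite /psum mulr_sumr -big_split; apply: eq_bigr => m _.
  exact: complexE.
by apply: cvgC_add xP _; apply: cvgC_mul yP; apply: cvg_cst.
Qed.

(** The family of the terms of F at the point z. *)
Definition scale z F : fps R d := fun m => F m * monom z m.

Lemma monomD z m1 m2 : monom z (m1 + m2)%MM = monom z m1 * monom z m2.
Proof.
by rewrite /monom -big_split; apply: eq_bigr => k _; rewrite mnmDE exprD.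
Qed.

Lemma scaleM z F G : scale z (fps_mul F G) = fps_mul (scale z F) (scale z G).
Proof.
apply/funext => m; rewrite /scale /fps_mul mulr_suml; apply: eq_bigr => k /eqP e.
by rewrite [in monom z m]e monomD mulrACA.
Qed.

Definition evaluates F z l := sums_to (scale z F) l.

Lemma evalsM F G z l l' : evaluates F z l -> evaluates G z l' -> evaluates (fps_mul F G) z (l * l').
Proof. by rewrite /evaluates scaleM; apply: sumsM. Qed.

Lemma evalsD F G z l l' :
  evaluates F z l -> evaluates G z l' -> evaluates (fun m => F m + G m) z (l + l').
Proof.
rewrite /evaluates => hF hG.
have -> : scale z (fun m => F m + G m) = fun m => scale z F m + scale z G m.
  by apply/funext => m; rewrite /scale mulrDl.
exact: sumsD.
Qed.

Lemma evals_unique F z l l' : evaluates F z l -> evaluates F z l' -> l = l'.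
Proof. by move=> [_ h] [_ h']; apply: cvg_unique h h'. Qed.

Lemma evals_poly (S : Pol) z : evaluates (fps_poly S) z S.@[fun k => z 0 k].
Proof.
elim/mpoly_ring_ind: S => [c|k|p q IHp IHq|p q IHp IHq].
- have e : scale z (fps_poly c%:MP) 0%MM = c.
    rewrite /scale /fps_poly mcoeffC eqxx mulr1 /monom big1 ?mulr1 // => k _.
    by rewrite mnm0E.
  rewrite mevalC -[X in evaluates _ _ X]e; apply: sums_single => m /negbTE m0.
  by rewrite /scale /fps_poly mcoeffC m0 mulr0 mul0r.
- have e : scale z (fps_poly 'X_k) U_(k)%MM = z 0 k.
    rewrite /scale /fps_poly mcoeffX eqxx mul1r /monom (bigD1 k) //= big1 ?mulr1.
      by rewrite mnm1E eqxx.
    by move=> j /negbTE njk; rewrite mnm1E eq_sym njk.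
  rewrite mevalXU -[X in evaluates _ _ X]e; apply: sums_single => m /negbTE nm.
  by rewrite /scale /fps_poly mcoeffX eq_sym nm mul0r.
- have -> : fps_poly (p + q) = fun m => fps_poly p m + fps_poly q m.
    by apply/funext => m; rewrite /fps_poly mcoeffD.
  by rewrite mevalD; apply: (evalsD IHp IHq).
- have -> : fps_poly (p * q) = fps_mul (fps_poly p) (fps_poly q).
    by apply/funext => m; apply: mcoeffM.
  by rewrite mevalM; apply: (evalsM IHp IHq).
Qed.

(** e^nu is the generating function of evaluation at nu, and translating the
    argument by mu evaluates at mu + nu. *)
Lemma fps_expD mu nu : fps_exp (mu + nu) = fps_mul (fps_exp mu) (fps_exp nu).
Proof.
have genE w : genfun (fun p : Pol => p.@[fun k => w 0 k]) = fps_exp w.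
  by apply/funext => m; rewrite /genfun mevalX.
rewrite -(genE nu) -genfun_shift => [|a p q]; last by rewrite mevalD mevalZ.
rewrite -genE; congr genfun; apply/funext => p /=.
elim/mpoly_ring_ind: p => [c|k|p q IHp IHq|p q IHp IHq].
- by rewrite shiftC !mevalC.
- by rewrite shift_X mevalD mevalC !mevalXU mxE addrC.
- by rewrite shiftD !mevalD IHp IHq.
- by rewrite shiftM !mevalM IHp IHq.
Qed.

Lemma expCD (x y : C) : expC (x + y) = expC x * expC y.
Proof.
case: x y => [x1 x2] [y1 y2]; rewrite /expC /=; simpc.
rewrite expRD cosD sinD; congr (_ +i* _)%C; ring.
Qed.

Lemma expC0 : expC (0 : C) = 1.
Proof. by rewrite /expC /= expR0 cos0 sin0 mul1r mulr0. Qed.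

(** Only the monomials y_k^j contribute. *)
Lemma psum_exp_line k (x : C) N : psum (fps_exp (x *: delta_mx 0 k : 'rV[C]_d)) N =
  \sum_(j < N) x ^+ j / j`!%:R.
Proof.
have lt (j : 'I_N) : (mdeg (U_(k) *+ j)%MM < N)%N by rewrite mdegMn mdeg1 mul1n.
have mk (m : 'X_{1..d < N}) : (m k < N)%N.
  by apply: leq_ltn_trans (bmdeg m); rewrite mdegE (bigD1 k) //= leq_addr.
pose h (j : 'I_N) := BMultinom (lt j).
pose h' (m : 'X_{1..d < N}) := Ordinal (mk m).
have hj j i : (h j : 'X_{1..d}) i = if i == k then j : nat else 0%N.
  by rewrite /= mulmnE mnm1E eq_sym; case: eqP => _; rewrite ?mul1n ?mul0n.
rewrite /psum (bigID (fun m : 'X_{1..d < N} => m == h (h' m))) /= [X in _ + X]big1 ?addr0; last first.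
  move=> m nm; rewrite /fps_exp.
  have /existsP [i /andP [ik mi]] : [exists i, (i != k) && (m i != 0%N)].
    apply: contraNT nm => /existsPn n; apply/eqP/val_inj/mnmP => i; rewrite hj.
    by case: eqP => [->//|/eqP ik]; have := n i; rewrite ik /= negbK => /eqP.
  by rewrite (bigD1 i) //= !mxE (negbTE ik) andbF mulr0 expr0n (negbTE mi) !mul0r.
rewrite (reindex_onto h h') /=; last by move=> m /eqP.
rewrite (eq_bigl xpredT); last first.
  move=> j; have e : h' (h j) = j by apply: val_inj; rewrite /= -/(h j) hj eqxx.
  by rewrite -/(h j) e !eqxx.
apply: eq_bigr => j _; rewrite -/(h j) /fps_exp /mfact (bigD1 k) //= big1 ?mulr1; last first.
  by move=> i /negbTE ik; rewrite -/(h j) hj ik expr0.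
rewrite (bigD1 k) //= big1 ?muln1; last first.
  by move=> i /negbTE ik; rewrite -/(h j) hj ik.
by rewrite -/(h j) hj eqxx !mxE !eqxx mulr1.
Qed.

Lemma fabs_exp w : fabs (fps_exp w) = fps_exp (map_mx (fun x => `|x|) w).
Proof.
apply/funext => m; rewrite /fabs /fps_exp normrM normfV normr_nat normr_prod.
by congr (_ / _); apply: eq_bigr => k _; rewrite normrX mxE.
Qed.

Lemma cvg_expR_series (x : R) :
  (fun N => \sum_(j < N) cofR x ^+ j / j`!%:R) @ \oo --> cofR (expR x).
Proof.
have -> : (fun N => \sum_(j < N) cofR x ^+ j / j`!%:R) =
    (fun N => cofR (series (exp_coeff x) N)).
  apply/funext => N; rewrite /series /= big_mkord /cofR rmorph_sum.
  by apply: eq_bigr => j _; rewrite rmorphM rmorphXn fmorphV rmorph_nat.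
apply: cvg_cofR; rewrite /expR; exact: is_cvg_series_exp_coeff.
Qed.

Lemma exp_series_le (x : R) N : 0 <= x ->
  \sum_(j < N) cofR x ^+ j / j`!%:R <= cofR (expR x).
Proof.
move=> x0; have -> : \sum_(j < N) cofR x ^+ j / j`!%:R = cofR (series (exp_coeff x) N).
  rewrite /series /= big_mkord /cofR rmorph_sum.
  by apply: eq_bigr => j _; rewrite rmorphM rmorphXn fmorphV rmorph_nat.
rewrite /cofR lecR /expR; apply: nondecreasing_cvgn_le.
  by apply: nondecreasing_series => n _ _; apply: exp_coeff_ge0.
exact: is_cvg_series_exp_coeff.
Qed.

Lemma sums_exp_line k (x l : C) : (fun N => \sum_(j < N) x ^+ j / j`!%:R) @ \oo --> l ->
  sums_to (fps_exp (x *: delta_mx 0 k : 'rV[C]_d)) l.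
Proof.
move=> xl; split; last first.
  have -> : psum (fps_exp (x *: delta_mx 0 k : 'rV[C]_d)) =
    (fun N => \sum_(j < N) x ^+ j / j`!%:R) by apply/funext => N; apply: psum_exp_line.
  by [].
exists (cofR (expR (complex.Re `|x|))) => N; rewrite fabs_exp.
have -> : map_mx (fun y => `|y|) (x *: delta_mx 0 k) = `|x| *: (delta_mx 0 k : 'rV[C]_d).
  by apply/matrixP => i j; rewrite !mxE normrM normr_nat.
rewrite psum_exp_line {1}(cofR_Re (normr_real x)); apply: exp_series_le.
by rewrite -ler0c -/(cofR _) -cofR_Re ?normr_ge0 ?normr_real.
Qed.

(** The terms of the exponential series of iy are those of cos y + i sin y. *)
Lemma expr_imaginary (y : R) j : ('i%C * cofR y) ^+ j / j`!%:R =
  (cos_coeff y j +i* sin_coeff y j)%C :> C.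
Proof.
have -> : (j`!%:R)^-1 = cofR (j`!%:R^-1) :> C.
  by rewrite /cofR fmorphV rmorph_nat.
have e : ('i%C * cofR y) ^+ j = (((~~ odd j)%:R * (-1) ^+ j./2 * y ^+ j) +i*
   ((odd j)%:R * (-1) ^+ j.-1./2 * y ^+ j))%C :> C.
  have aux n : ('i%C * cofR y) ^+ n.*2 = cofR ((-1) ^+ n * y ^+ n.*2).
    rewrite -mul2n exprM (_ : _ ^+ 2 = cofR (- y ^+ 2)).
      by rewrite /cofR -rmorphXn /= exprM -exprNn.
    by rewrite exprMn sqr_i /cofR rmorphN rmorphXn mulN1r.
  have := odd_double_half j; case: (odd j) => <-.
    rewrite add1n exprS aux /= doubleK uphalf_double mul0r mul0r mul1r /cofR exprS.
    by simpc; congr (_ +i* _)%C; ring.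
  by rewrite add0n aux /= doubleK mul1r !mul0r.
by rewrite e /cofR; simpc; rewrite /cos_coeff /sin_coeff.
Qed.

Lemma cvg_exp_series_imaginary (y : R) :
  (fun N => \sum_(j < N) ('i%C * cofR y) ^+ j / j`!%:R) @ \oo --> expC ('i%C * cofR y).
Proof.
have -> : expC ('i%C * cofR y) = (cos y +i* sin y)%C.
  by rewrite /expC /cofR; simpc; rewrite /= expR0 !mul1r.
have sE N : \sum_(j < N) ('i%C * cofR y) ^+ j / j`!%:R =
    (series (cos_coeff y) N +i* series (sin_coeff y) N)%C :> C.
  rewrite /series /= !big_mkord; elim: N => [|N IH]; first by rewrite !big_ord0.
  by rewrite !big_ord_recr /= IH expr_imaginary.
apply: cvg_complex.
  have -> : (fun N => complex.Re (\sum_(j < N) ('i%C * cofR y) ^+ j / j`!%:R)) =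
    series (cos_coeff y) by apply/funext => N; rewrite sE.
  rewrite cos.unlock; exact: is_cvg_series_cos_coeff.
have -> : (fun N => complex.Im (\sum_(j < N) ('i%C * cofR y) ^+ j / j`!%:R)) =
  series (sin_coeff y) by apply/funext => N; rewrite sE.
rewrite sin.unlock; exact: is_cvg_series_sin_coeff.
Qed.

(** Both sides are multiplicative in w, so it suffices to treat real and purely
    imaginary multiples of the basis vectors. *)
Lemma sums_exp w : sums_to (fps_exp w) (expC (\sum_k w 0 k)).
Proof.
pose P w' := sums_to (fps_exp w') (expC (\sum_k (w' : 'rV[C]_d) 0 k)).
have PD u v : P u -> P v -> P (u + v).
  move=> Pu Pv; rewrite /P fps_expD.
  have -> : \sum_k (u + v) 0 k = \sum_k u 0 k + \sum_k v 0 k.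
    by rewrite -big_split; apply: eq_bigr => k _; rewrite mxE.
  by rewrite expCD; apply: (sumsM Pu Pv).
have P0 : P 0.
  rewrite /P big1 => [|k _]; last by rewrite mxE.
  rewrite expC0 -(fps_exp0 (0 : 'rV[C]_d)); apply: sums_single => m m0.
  have /existsP [k mk] : [exists k, m k != 0%N].
    apply: contraNT m0 => /existsPn n; apply/eqP/mnmP => k.
    by have := n k; rewrite negbK mnm0E => /eqP.
  by rewrite /fps_exp (bigD1 k) //= mxE expr0n (negbTE mk) !mul0r.
have sum_line (x : C) k : \sum_j (x *: delta_mx 0 k : 'rV[C]_d) 0 j = x.
  rewrite (bigD1 k) //= big1 ?addr0; first by rewrite !mxE !eqxx mulr1.
  by move=> j /negbTE nj; rewrite !mxE nj andbF mulr0.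
have Pline x k : P (x *: delta_mx 0 k).
  rewrite [x]complexE scalerDl; apply: PD; rewrite /P sum_line.
    apply: sums_exp_line; have -> : expC ((complex.Re x)%:C)%C = cofR (expR (complex.Re x)).
      by rewrite /expC /cofR /= cos0 sin0 mulr1 mulr0.
    exact: cvg_expR_series.
  by apply: sums_exp_line; apply: cvg_exp_series_imaginary.
have -> : w = \sum_k w 0 k *: delta_mx 0 k.
  by rewrite {1}[w]row_sum_delta.
rewrite -/(P _); apply: (big_ind P P0 PD) => k _; exact: Pline.
Qed.

Lemma evals_exp mu z : evaluates (fps_exp mu) z (expC (dot mu z)).
Proof.
rewrite /evaluates; have := sums_exp (\row_k (mu 0 k * z 0 k)).
have -> : scale z (fps_exp mu) = fps_exp (\row_k (mu 0 k * z 0 k)).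
  apply/funext => m; rewrite /scale /fps_exp /monom mulrAC -big_split /=.
  by congr (_ / _); apply: eq_bigr => k _; rewrite mxE exprMn.
by congr (sums_to _ (expC _)); apply: eq_bigr => k _; rewrite mxE.
Qed.

End Evaluation.

(** * Division of power series and geometric bounds *)

Section Division.
Local Open Scope classical_set_scope.
Variables (R : realType) (d : nat).
Local Notation C := (Cx R).
Implicit Types (u D : fps R d) (m a : 'X_{1..d}) (W : 'I_d -> nat).

(** A grading with y_k in degree W k. *)
Definition weight W m := (\sum_k W k * m k)%N.

Lemma weightD W m1 m2 : weight W (m1 + m2) = (weight W m1 + weight W m2)%N.
Proof.
by rewrite /weight -big_split; apply: eq_bigr => k _; rewrite mnmDE mulnDr.
Qed.

(** The term of D of least weight is a single monomial, a.  Weights between 1 and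
    2 keep the grading comparable with the total degree. *)
Definition has_tip D W a := [/\ (forall k, (0 < W k <= 2)%N), D a != 0 &
  forall m, D m != 0 -> m != a -> (weight W a < weight W m)%N].

Lemma leq_mdeg_weight W m : (forall k, (0 < W k <= 2)%N) -> (mdeg m <= weight W m)%N.
Proof.
move=> W12; rewrite mdegE; apply: leq_sum => k _.
by have /andP [W0 _] := W12 k; rewrite leq_pmull.
Qed.

Lemma leq_weight_mdeg W m : (forall k, (0 < W k <= 2)%N) -> (weight W m <= 2 * mdeg m)%N.
Proof.
move=> W12; rewrite mdegE big_distrr; apply: leq_sum => k _.
by have /andP [_ W2] := W12 k; rewrite leq_mul2r W2 orbT.
Qed.

Lemma fps_mul_lin u D m : fps_mul u D m =
  \sum_(k : 'X_{1..d < (mdeg m).+1} | (k <= m)%MM) u (m - k)%MM * D k.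
Proof.
rewrite (fps_mulE _ _ (ltnSn _)).
rewrite (_ : (_ * _)@_m = \sum_(k : 'X_{1..d < (mdeg m).+1} | (k <= m)%MM)
   (trunc (mdeg m).+1 u)@_(m - k) * (trunc (mdeg m).+1 D)@_k).
  apply: eq_bigr => k _; rewrite !mcoeff_trunc ?bmdeg //.
  by rewrite ltnS mdegB.
by apply: mcoeff_poly_mul_lin_rev.
Qed.

(** The coefficient of u D at m + a expresses u_m through coefficients of u of
    smaller weight and through u D.  With t small against the ratio of |D_a| to
    the sum KD of the |D_k|, the quantity |u_m| t^(weight m) stays bounded: the
    terms of larger weight in D contribute at most half of the bound.  The
    constants do not depend on u, and the bound is proportional to K, so that
    u D = 0 forces u = 0. *)
Lemma fps_div_bound D W a (KD rho0 : C) : has_tip D W a ->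
  (forall N, psum (fabs D) N <= KD) -> 1 <= rho0 ->
  exists c rho : C, [/\ 0 <= c, 1 <= rho & forall u (K : C), 0 <= K ->
    (forall m, `|fps_mul u D m| <= K * rho0 ^+ mdeg m) ->
    forall m, `|u m| <= c * K * rho ^+ mdeg m].
Proof.
move=> [W12 Da Dtip] DK rho1.
pose nDa := `|D a|; have nDa0 : 0 < nDa by rewrite normr_gt0.
have dK : nDa <= KD.
  apply: le_trans (DK (mdeg a).+1); rewrite /psum (bigD1 (BMultinom (ltnSn _))) //=.
  by rewrite lerDl; apply: sumr_ge0 => k _; apply: normr_ge0.
have KD0 : 0 < KD by apply: lt_le_trans dK.
have rho0_gt0 : 0 < rho0 by apply: lt_le_trans rho1.
(* Small enough for t * KD <= |D_a| / 2 and t * rho0 <= 1. *)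
pose t := nDa / (2 * KD) / rho0.
have t0 : 0 < t by rewrite !divr_gt0 // mulr_gt0.
have trho : t * rho0 <= 1.
  rewrite /t divfK ?gt_eqF // ler_pdivrMr ?mulr_gt0 // mul1r.
  by apply: le_trans dK _; rewrite ler_peMl ?ler1n // ltW.
have t1 : t <= 1 by apply: le_trans trho; rewrite ler_peMr // ltW.
have tKD : t * KD <= nDa / 2.
  have -> : t * KD = nDa / 2 / rho0 by rewrite /t; field; rewrite !gt_eqF.
  by rewrite ler_pdivrMr // ler_peMr // divr_ge0 // ltW.
clearbody t.
have ge0 n : 0 <= t ^+ n by rewrite exprn_ge0 // ltW.
pose c := 2 / (nDa * t ^+ weight W a).
have c0 : 0 <= c by rewrite divr_ge0 // mulr_ge0 // ltW.
exists c, (t^-1 ^+ 2); split => //.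
  by rewrite exprn_ege1 // invf_ge1.
move=> u K K0 uD m; set B := c * K.
have B0 : 0 <= B by rewrite mulr_ge0.
suff main : `|u m| * t ^+ weight W m <= B.
  have -> : `|u m| = `|u m| * t ^+ weight W m * t^-1 ^+ weight W m.
    by rewrite -mulrA -exprMn mulfV ?gt_eqF // expr1n mulr1.
  apply: ler_pM => //; first by rewrite mulr_ge0.
    by rewrite exprn_ge0 // invr_ge0 ltW.
  by rewrite -exprM ler_weXn2l ?invf_ge1 // leq_weight_mdeg.
(* Induction on the weight of m, reading off the coefficient of u D at M. *)
have [n] := ubnP (weight W m); elim: n m => // n IH m; rewrite ltnS => le_m_n.
pose M := (m + a)%MM.
have lta : (mdeg a < (mdeg M).+1)%N by rewrite ltnS mdegD leq_addl.
have rec : u m * D a = fps_mul u D M -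
    \sum_(k : 'X_{1..d < (mdeg M).+1} | (k <= M)%MM && (k != BMultinom lta))
       u (M - k)%MM * D k.
  rewrite fps_mul_lin (bigD1 (BMultinom lta)) /=; last first.
    by rewrite /M addmC; apply/mnm_lepP => k; rewrite mnmDE leq_addr.
  rewrite addrK (_ : (M - a)%MM = m) //.
  by apply/mnmP => k; rewrite mnmBE mnmDE addnK.
have bound : `|u m| * nDa * t ^+ (weight W m + weight W a) <= K + B * (t ^+ (weight W a).+1 * KD).
  rewrite -normrM rec; apply: le_trans (ler_wpM2r (ge0 _) (ler_normB _ _)) _.
  rewrite mulrDl; apply: lerD.
    apply: le_trans (ler_wpM2r (ge0 _) (uD M)) _.
    rewrite -weightD -/M -mulrA ler_piMr //.
    apply: (@le_trans _ _ ((t * rho0) ^+ mdeg M)); last first.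
      by rewrite exprn_ile1 // mulr_ge0 // ltW.
    rewrite exprMn mulrC; apply: ler_wpM2r; first by rewrite exprn_ge0 // ltW.
    by rewrite ler_wiXn2l ?leq_mdeg_weight // ltW.
  apply: le_trans (ler_wpM2r (ge0 _) (ler_norm_sum _ _ _)) _.
  apply: (@le_trans _ _ (B * (t ^+ (weight W a).+1 * psum (fabs D) (mdeg M).+1))); last first.
    by rewrite ler_wpM2l // ler_wpM2l.
  rewrite mulr_suml /psum !mulr_sumr big_mkcond /=; apply: ler_sum => k _.
  have rhs0 : 0 <= B * (t ^+ (weight W a).+1 * fabs D k).
    by apply: mulr_ge0 => //; apply: mulr_ge0 => //; apply: fabs_ge0.
  case: ifP => // /andP [kM nka].
  have [Dk0|Dk] := eqVneq (D k) 0; first by rewrite Dk0 mulr0 normr0 mul0r.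
  have lt_k : (weight W a < weight W k)%N by apply: Dtip.
  have wM : (weight W (M - k) + weight W k = weight W m + weight W a)%N by rewrite -!weightD submK.
  rewrite -wM exprD normrM mulrACA; apply: ler_pM; rewrite ?mulr_ge0 //.
    apply: IH; apply: leq_trans le_m_n.
    by rewrite -(ltn_add2r (weight W k)) wM ltn_add2l.
  by rewrite mulrC ler_wpM2r // ler_wiXn2l // ltW.
have pos : 0 < nDa * t ^+ weight W a by rewrite mulr_gt0 // exprn_gt0.
rewrite -(ler_pM2r pos) (le_trans _ (le_trans bound _)) //.
  by rewrite exprD mulrACA.
have KE : K = B * (nDa * t ^+ weight W a / 2).
  by rewrite /B /c; field; rewrite !gt_eqF // exprn_gt0.
rewrite {1}KE -mulrDr ler_wpM2l //.
have -> : t ^+ (weight W a).+1 * KD = t ^+ weight W a * (t * KD) by rewrite exprSr mulrA.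
apply: le_trans (lerD (lexx _) (ler_wpM2l (ge0 _) tKD)) _.
by rewrite le_eqVlt; apply/orP; left; apply/eqP; field.
Qed.

Lemma fps_mul_eq0 D W a u (KD : C) : has_tip D W a ->
  (forall N, psum (fabs D) N <= KD) ->
  fps_mul u D = (fun=> 0) -> u = (fun=> 0).
Proof.
move=> Dtip DK uD.
have [c [rho [_ _ H]]] := fps_div_bound Dtip DK (lexx 1).
apply/funext => m; apply/eqP; rewrite -normr_le0.
have := H u 0 (lexx _) _ m; rewrite mulr0 mul0r; apply => m'.
by rewrite uD normr0 mul0r.
Qed.

Definition geometric u := exists K rho : C,
  [/\ 0 <= K, 1 <= rho & forall m, `|u m| <= K * rho ^+ mdeg m].

Lemma geometric_div D W a u (KD : C) : has_tip D W a ->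
  (forall N, psum (fabs D) N <= KD) ->
  geometric (fps_mul u D) -> geometric u.
Proof.
move=> Dtip DK [K [rho [K0 rho1 uD]]].
have [c [rho' [c0 rho'1 H]]] := fps_div_bound Dtip DK rho1.
by exists (c * K), rho'; split => //; [apply: mulr_ge0|apply: H].
Qed.

Lemma geometric_abs_bounded u (B : C) : (forall N, psum (fabs u) N <= B) -> geometric u.
Proof.
move=> uB; have uB1 m : `|u m| <= B.
  apply: le_trans (uB (mdeg m).+1); rewrite /psum (bigD1 (BMultinom (ltnSn _))) //=.
  by rewrite lerDl; apply: sumr_ge0 => k _; apply: normr_ge0.
exists B, 1; split => // [|m]; last by rewrite expr1n mulr1.
by apply: le_trans (uB1 0%MM); apply: normr_ge0.
Qed.

(** The sum is at most the sum over all exponents up to N in each variable,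
    which is a product of d geometric sums. *)
Lemma psum_geometric N : psum (fun m : 'X_{1..d} => 2^-1 ^+ mdeg m : C) N <= 2 ^+ d.
Proof.
have half n : \sum_(j < n) 2^-1 ^+ j <= 2 :> C.
  suff -> : \sum_(j < n) 2^-1 ^+ j = 2 - 2 * 2^-1 ^+ n :> C.
    by rewrite lerBlDr lerDl mulr_ge0 // exprn_ge0 // invr_ge0.
  elim: n => [|n IH]; first by rewrite big_ord0 expr0 mulr1 subrr.
  by rewrite big_ord_recr /= IH exprS; field.
pose h (m : 'X_{1..d < N}) : {ffun 'I_d -> 'I_N.+1} := [ffun k => inord (m k)].
have hE (m : 'X_{1..d < N}) k : h m k = m k :> nat.
  rewrite ffunE inordK // ltnS; apply: leq_trans (ltnW (bmdeg m)).
  by rewrite mdegE (bigD1 k) //= leq_addr.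
have h_inj : injective h.
  move=> m1 m2 e; apply/val_inj/mnmP => k.
  by rewrite -[LHS](hE m1) -[RHS](hE m2) e.
apply: (@le_trans _ _ (\sum_(f : {ffun 'I_d -> 'I_N.+1}) \prod_k 2^-1 ^+ f k)).
  rewrite [leRHS](bigID (mem [set h m | m : 'X_{1..d < N}]%SET)) /=.
  rewrite (big_imset _ (in2W h_inj)) /=.
  rewrite (eq_bigr (fun m : 'X_{1..d < N} => 2^-1 ^+ mdeg m)); last first.
    by move=> m _; rewrite mdegE -prodrXr; apply: eq_bigr => k _; rewrite hE.
  rewrite /psum lerDl; apply: sumr_ge0 => f _; apply: prodr_ge0 => k _.
  by rewrite exprn_ge0 // invr_ge0.
rewrite -(bigA_distr_bigA (fun (k : 'I_d) (j : 'I_N.+1) => 2^-1 ^+ j : C)) /=.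
have -> : 2 ^+ d = \prod_(k < d) 2 :> C by rewrite prodr_const card_ord.
apply: ler_prod => k _; rewrite half andbT; apply: sumr_ge0 => j _.
by rewrite exprn_ge0 // invr_ge0.
Qed.

Lemma geometric_near0 u : geometric u ->
  \forall z \near (0 : 'rV[C]_d), exists B, forall N, psum (fabs (scale z u)) N <= B.
Proof.
move=> [K [rho [K0 rho1 uP]]].
have rho0 : 0 < rho by apply: lt_le_trans rho1.
apply/nbhs_ballP; exists ((2 * rho)^-1) => /=; first by rewrite invr_gt0 mulr_gt0.
move=> z [_ zr]; exists (K * 2 ^+ d) => N.
apply: le_trans (ler_wpM2l K0 (psum_geometric N)); rewrite /psum mulr_sumr.
apply: ler_sum => m _; rewrite /fabs /scale normrM.
have -> : K * 2^-1 ^+ mdeg m = K * rho ^+ mdeg m * (2 * rho)^-1 ^+ mdeg m :> C.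
  rewrite -mulrA -exprMn; congr (_ * _ ^+ _); field.
  by rewrite gt_eqF.
apply: ler_pM => //; rewrite /monom normr_prod mdegE -prodrXr.
apply: ler_prod => k _; rewrite normr_ge0 normrX /=.
apply: lerXn2r; rewrite ?nnegrE ?invr_ge0 ?mulr_ge0 // ?ltW //.
by have := zr 0 k; rewrite -ball_normE /ball_ /= mxE sub0r normrN.
Qed.

(** The constant term is 1 - q.  If q = 1 the series starts with the linear form
    l; giving weight 1 to one variable that occurs in it and weight 2 to all
    others singles out this variable. *)
Lemma sinh_fps_has_tip (q : C) (l : 'rV[int]_d) : l != 0 ->
  exists W a, has_tip (sinh_fps q l) W a.
Proof.
move=> l0.
have s0 : sinh_fps q l 0%MM = 1 - q by rewrite /sinh_fps !fps_exp0 mulr1.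
have [q1|nq1] := eqVneq q 1; last first.
  exists (fun=> 1%N), 0%MM; split => // [|m _ m0].
    by rewrite s0 subr_eq0 eq_sym.
  have w1 m' : weight (fun=> 1%N) m' = mdeg m'.
    by rewrite /weight mdegE; apply: eq_bigr => k _; rewrite mul1n.
  by rewrite !w1 mdeg0 lt0n mdeg_eq0.
have /existsP [k0 lk0] : [exists k, l 0 k != 0].
  apply: contraNT l0 => /existsPn n; apply/eqP/rowP => k.
  by have := n k; rewrite negbK mxE => /eqP.
have e1 (mu : 'rV[C]_d) k : fps_exp mu U_(k)%MM = mu 0 k.
  rewrite /fps_exp /mfact (bigD1 k) //= mnm1E eqxx big1 => [|j /negbTE njk]; last first.
    by rewrite mnm1E eq_sym njk.
  rewrite (bigD1 k) //= mnm1E eqxx big1 => [|j /negbTE njk]; last first.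
    by rewrite mnm1E eq_sym njk.
  by rewrite mulr1 muln1 divr1.
have W12 k : (0 < (if k == k0 then 1 else 2) <= 2)%N by case: ifP.
exists (fun k => if k == k0 then 1%N else 2%N), U_(k0)%MM; split => //.
  rewrite /sinh_fps !e1 q1 mul1r !mxE opprK -mulrDl.
  have -> : 2^-1 + 2^-1 = 1 :> C by field.
  by rewrite mul1r intr_eq0.
move=> m sm mk0.
have -> : weight (fun k => if k == k0 then 1%N else 2%N) U_(k0) = 1%N.
  rewrite /weight (bigD1 k0) //= eqxx mnm1E eqxx big1 // => j /negbTE nj.
  by rewrite mnm1E (eq_sym k0) nj muln0.
have m0 : mdeg m != 0%N.
  by apply: contraNneq sm => /eqP; rewrite mdeg_eq0 => /eqP ->; rewrite s0 q1 subrr.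
have [m1|nm1] := eqVneq (mdeg m) 1%N.
  have /mdeg1P [j /eqP mj] : mdeg m == 1%N by rewrite m1.
  rewrite mj /weight (bigD1 j) //= mnm1E eqxx; case: eqP => [jk|_] //.
  by move: mk0; rewrite mj jk eqxx.
apply: leq_trans (leq_mdeg_weight m W12).
by case: (mdeg m) m0 nm1 => [|[]].
Qed.

End Division.

(** * Entire functions and the denominator *)

Section Entire.
Local Open Scope classical_set_scope.
Variables (R : realType) (d : nat).
Local Notation C := (Cx R).
Local Notation Pol := {mpoly C[d]}.
Implicit Types (F G : fps R d) (z p mu : 'rV[C]_d) (f h : 'rV[C]_d -> C).

Lemma evalsZ F z l (a : C) : evaluates F z l -> evaluates (fun m => a * F m) z (a * l).
Proof.
move=> Fl; have := evalsM (evals_poly a%:MP z) Fl; rewrite mevalC.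
have -> : fps_poly (a%:MP : Pol) = fun m => a * fps_one R m.
  by apply/funext => m; rewrite /fps_poly mcoeffC.
by rewrite fps_mulZl fps_mul1.
Qed.

Lemma evals_one z : evaluates (@fps_one R d) z 1.
Proof.
have -> : @fps_one R d = fps_poly 1 by apply/funext => m; rewrite /fps_poly mcoeff1.
by have := evals_poly (1 : Pol) z; rewrite meval1.
Qed.

(** The expansion at each point is required to converge everywhere. *)
Definition entire f := forall p, exists F, forall z, evaluates F (z - p) (f z).

Lemma entire_holomorphic f p : entire f -> holomorphic_at f p.
Proof.
by move=> /(_ p) [F FP]; exists F; apply: (@filterE _ (nbhs p) (nbhs_filter p)) => z; apply: FP.
Qed.

Lemma entireM f h : entire f -> entire h -> entire (fun z => f z * h z).
Proof.
move=> ef eh p; have [F FP] := ef p; have [H HP] := eh p.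
by exists (fps_mul F H) => z; apply: evalsM.
Qed.

Lemma entireD f h : entire f -> entire h -> entire (fun z => f z + h z).
Proof.
move=> ef eh p; have [F FP] := ef p; have [H HP] := eh p.
by exists (fun m => F m + H m) => z; apply: evalsD.
Qed.

Lemma entireZ (a : C) f : entire f -> entire (fun z => a * f z).
Proof.
move=> ef p; have [F FP] := ef p.
by exists (fun m => a * F m) => z; apply: evalsZ.
Qed.

Lemma entire_poly (S : Pol) : entire (fun z => S.@[fun k => z 0 k]).
Proof.
move=> p; exists (fps_poly (shift p S)) => z.
have := evals_poly (shift p S) (z - p); rewrite shift.unlock comp_mpoly_meval.
congr evaluates; apply: meval_eq => k.
by rewrite tnth_mktuple mevalD mevalXU mevalC !mxE subrK.
Qed.

Lemma dotDr (u v w : 'rV[C]_d) : dot u (v + w) = dot u v + dot u w.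
Proof. by rewrite /dot -big_split; apply: eq_bigr => k _; rewrite mxE mulrDr. Qed.

Lemma dotNl (u v : 'rV[C]_d) : dot (- u) v = - dot u v.
Proof. by rewrite /dot -sumrN; apply: eq_bigr => k _; rewrite mxE mulNr. Qed.

Lemma entire_exp mu : entire (fun z => expC (dot mu z)).
Proof.
move=> p; exists (fun m => expC (dot mu p) * fps_exp mu m) => z.
have -> : expC (dot mu z) = expC (dot mu p) * expC (dot mu (z - p)).
  by rewrite -expCD -dotDr addrC subrK.
exact/evalsZ/evals_exp.
Qed.

Lemma entire_sum (I : Type) (r : seq I) (f : I -> 'rV[C]_d -> C) :
  (forall i, entire (f i)) -> entire (fun z => \sum_(i <- r) f i z).
Proof.
move=> ef; elim: r => [|i r IH].
  have := entire_poly 0; congr entire; apply/funext => z.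
  by rewrite meval0 big_nil.
have := entireD (ef i) IH; congr entire; apply/funext => z.
by rewrite big_cons.
Qed.

Lemma entire_prod (I : Type) (r : seq I) (f : I -> 'rV[C]_d -> C) :
  (forall i, entire (f i)) -> entire (fun z => \prod_(i <- r) f i z).
Proof.
move=> ef; elim: r => [|i r IH].
  have := entire_poly 1; congr entire; apply/funext => z.
  by rewrite meval1 big_nil.
have := entireM (ef i) IH; congr entire; apply/funext => z.
by rewrite big_cons.
Qed.

Lemma entire_num M (S : 'rV[C]_d -> Pol) : entire (fun_num M S).
Proof.
by apply: entire_sum => mu; apply: entireM; [apply: entire_poly|apply: entire_exp].
Qed.

Lemma entire_den zeta L lam : entire (@fun_den R d zeta L lam).
Proof.
apply: entire_prod => l.
have := entireD (entire_exp (half_coweight R (lam l)))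
  (entireZ (- twist_factor zeta (lam l)) (entire_exp (- half_coweight R (lam l)))).
by congr entire; apply/funext => z; rewrite mulNr dotNl.
Qed.

Lemma evals_num M (S : 'rV[C]_d -> Pol) z : evaluates (fps_num M S) z (fun_num M S z).
Proof.
elim: M => [|mu M IH].
  have := evals_poly (0 : Pol) z; rewrite meval0 /fun_num big_nil.
  by congr evaluates; apply/funext => m; rewrite /fps_num big_nil /fps_poly mcoeff0.
have := evalsD (evalsM (evals_poly (S mu) z) (evals_exp mu z)) IH.
rewrite /fun_num big_cons; congr evaluates.
by apply/funext => m; rewrite /fps_num big_cons.
Qed.

Lemma evals_sinh (q : C) (l : 'rV[int]_d) z : evaluates (sinh_fps q l) z
  (expC (dot (half_coweight R l) z) - q * expC (- dot (half_coweight R l) z)).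
Proof.
have := evalsD (evals_exp (half_coweight R l) z)
  (evalsZ (- q) (evals_exp (- half_coweight R l) z)).
rewrite mulNr dotNl; congr evaluates.
by apply/funext => m; rewrite /sinh_fps mulNr.
Qed.

Lemma evals_den zeta L lam z :
  evaluates (@fps_den R d zeta L lam) z (fun_den zeta L lam z).
Proof.
elim: L => [|l L IH].
  by rewrite /fps_den /fun_den !big_nil; apply: evals_one.
rewrite /fps_den /fun_den !big_cons.
exact: (evalsM (evals_sinh _ _ _) IH).
Qed.

Lemma evals_abs_bounded F : (forall z, exists l, evaluates F z l) ->
  exists B, forall N, psum (fabs F) N <= B.
Proof.
move=> /(_ (const_mx 1)) [l' [[B BP] _]]; exists B => N.
have -> : F = scale (const_mx 1) F.
  apply/funext => m; rewrite /scale /monom big1 ?mulr1 // => k _.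
  by rewrite mxE expr1n.
exact: BP.
Qed.

End Entire.

Section Denominator.
Local Open Scope classical_set_scope.
Variables (R : realType) (d : nat).
Local Notation C := (Cx R).
Variables (zeta : 'rV[C]_d) (lam : {vspace 'rV[C]_d} -> 'rV[int]_d).
Implicit Types (L : seq {vspace 'rV[C]_d}) (u : fps R d).

Let lam_neq0 L := forall l, l \in L -> lam l != 0.

Lemma sinh_abs_bounded (q : C) (l : 'rV[int]_d) :
  exists B, forall N, psum (fabs (sinh_fps q l)) N <= B.
Proof.
by apply: evals_abs_bounded => z; eexists; apply: evals_sinh.
Qed.

Lemma sinh_mul_eq0 (q : C) (l : 'rV[int]_d) u : l != 0 ->
  fps_mul u (sinh_fps q l) = (fun=> 0) -> u = (fun=> 0).
Proof.
move=> l0; have [W [a tipD]] := sinh_fps_has_tip q l0.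
have [B BP] := sinh_abs_bounded q l; exact: fps_mul_eq0 tipD BP.
Qed.

Lemma fps_den_cons l L :
  fps_den zeta (l :: L) lam =
  fps_mul (sinh_fps (twist_factor zeta (lam l)) (lam l)) (fps_den zeta L lam).
Proof. by rewrite /fps_den big_cons. Qed.

Lemma fps_den_neq0 L : lam_neq0 L -> fps_den zeta L lam <> (fun=> 0).
Proof.
elim: L => [_|l L IH nz].
  move=> /(congr1 (fun F => F 0%MM)); rewrite /fps_den big_nil /fps_one eqxx.
  by move/eqP; rewrite oner_eq0.
rewrite fps_den_cons fps_mulC => /sinh_mul_eq0 e; apply: IH.
  by move=> l' l'L; apply: nz; rewrite in_cons l'L orbT.
by apply: e; apply: nz; rewrite mem_head.
Qed.

Lemma geometric_den L u : lam_neq0 L ->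
  geometric (fps_mul u (fps_den zeta L lam)) -> geometric u.
Proof.
elim: L => [_|l L IH nz].
  by rewrite /fps_den big_nil fps_mulC fps_mul1.
rewrite fps_den_cons (fps_mulC (sinh_fps _ _)) fps_mulA => gu; apply: IH.
  by move=> l' l'L; apply: nz; rewrite in_cons l'L orbT.
have l0 : lam l != 0 by apply: nz; rewrite mem_head.
have [W [a tipD]] := sinh_fps_has_tip (twist_factor zeta (lam l)) l0.
have [B BP] := sinh_abs_bounded (twist_factor zeta (lam l)) (lam l).
exact: geometric_div tipD BP gu.
Qed.

(** Take v = (1, B, B^2, ...) with B avoiding the finitely many roots of the
    polynomials with coefficient vectors lam l. *)
Lemma generic_direction L : lam_neq0 L ->
  exists v : 'rV[int]_d, forall l, l \in L -> dot (lam l) v != 0.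
Proof.
move=> nz; pose P := \prod_(l <- L) rVpoly (lam l).
have P0 : P != 0.
  rewrite /P prodf_seq_neq0; apply/allP => l lL /=.
  by apply: contra (nz l lL) => /eqP e; rewrite -[lam l]rVpolyK e linear0.
have [B PB] : exists B : nat, ~~ root P B%:Z.
  apply: contrapT => nB.
  pose rs := [seq n%:Z | n <- iota 0 (size P)].
  have rs_uniq : uniq rs by rewrite map_inj_uniq ?iota_uniq // => i j [].
  have rs_root : all (root P) rs.
    apply/allP => _ /mapP [j _ ->]; apply: contrapT => /negP nr.
    by apply: nB; exists j.
  by have := max_poly_roots P0 rs_root rs_uniq; rewrite size_map size_iota ltnn.
exists (\row_k B%:Z ^+ k) => l lL.
move: PB; rewrite /root /P horner_prod prodf_seq_neq0 => /allP /(_ l lL) /=.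
rewrite (horner_coef_wide _ (size_poly _ _)) /dot.
apply: contra => /eqP e; apply/eqP; rewrite -[RHS]e; apply: eq_bigr => k _.
by rewrite coef_rVpoly_ord mxE.
Qed.

Lemma norm_expC (x : C) : `|expC x| = cofR (expR (complex.Re x)).
Proof.
rewrite normc_def /expC /= !exprMn -mulrDr cos2Dsin2 mulr1.
by rewrite sqrtr_sqr ger0_norm // expR_ge0.
Qed.

Lemma cofRM (x y : R) : cofR (x * y) = cofR x * cofR y.
Proof. exact: rmorphM. Qed.

(** At a zero, |e^(h.z)|^2 = |q|.  Along a real line in a direction v with h.v
    real and nonzero, this norm is strictly monotone. *)
Lemma sinh_zero_unique (q : C) (h p v : 'rV[C]_d) (x s t : R) :
  dot h v = cofR x -> x != 0 ->
  let f r := expC (dot h (p + cofR r *: v)) - q * expC (- dot h (p + cofR r *: v)) in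
  f s = 0 -> f t = 0 -> s = t.
Proof.
move=> hv x0 f.
have dotE r : dot h (p + cofR r *: v) = dot h p + cofR (r * x).
  by rewrite dotDr dotZ hv cofRM.
pose y r := complex.Re (dot h p) + r * x.
have key r : f r = 0 -> expR (y r) ^+ 2 = complex.Re `|q|.
  rewrite /f dotE => /eqP; rewrite subr_eq0 => /eqP /(congr1 (fun w => `|w|)).
  rewrite normrM !norm_expC.
  have -> : complex.Re (dot h p + cofR (r * x)) = y r.
    by rewrite /y /cofR; case: (dot h p).
  have -> : complex.Re (- (dot h p + cofR (r * x))) = - y r.
    by rewrite /y /cofR; case: (dot h p).
  rewrite [in X in _ = X](cofR_Re (normr_real q)) -cofRM => /complexI e.
  by rewrite expr2 {2}e mulrCA -expRD subrr expR0 mulr1.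
move=> /key ys /key yt.
have : expR (y s) = expR (y t).
  apply/eqP; rewrite -(eqrXn2 (n := 2)) ?expR_ge0 //; apply/eqP.
  by rewrite ys yt.
by move=> /expR_inj /addrI /(mulIf x0).
Qed.

(** Consider the points p + v/(j + 1) with v a generic real direction.  Each
    factor vanishes for at most one j, and the points tend to p. *)
Lemma fun_den_not_near0 L (p : 'rV[C]_d) : lam_neq0 L ->
  ~ (\forall z \near p, fun_den zeta L lam z = 0).
Proof.
move=> nz; have [v vP] := generic_direction nz.
pose z (j : nat) := p + cofR (harmonic j) *: toC R v.
have ev : exists J, forall j, (J <= j)%N -> fun_den zeta L lam (z j) != 0.
  elim: L nz vP => [|l L IH] nz vP.
    by exists 0%N => j _; rewrite /fun_den big_nil oner_neq0.
  have [||J JP] := IH.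
  - by move=> l' l'L; apply: nz; rewrite in_cons l'L orbT.
  - by move=> l' l'L; apply: vP; rewrite in_cons l'L orbT.
  pose f j := expC (dot (half_coweight R (lam l)) (z j)) -
    twist_factor zeta (lam l) * expC (- dot (half_coweight R (lam l)) (z j)).
  have [J' J'P] : exists J', forall j, (J' <= j)%N -> f j != 0.
    have [[j0 fj0]|nf] := pselect (exists j, f j = 0); last first.
      by exists 0%N => j _; apply/eqP => fj; apply: nf; exists j.
    exists j0.+1 => j ltj; apply/eqP => fj.
    have hv : dot (half_coweight R (lam l)) (toC R v) = cofR (2^-1 * (dot (lam l) v)%:~R).
      rewrite cofRM /cofR fmorphV rmorph_nat rmorph_int -dot_toC /dot mulr_sumr.
      by apply: eq_bigr => k _; rewrite mxE mulrA.
    have x0 : 2^-1 * (dot (lam l) v)%:~R != 0 :> R.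
      apply: mulf_neq0; first by rewrite invr_eq0 pnatr_eq0.
      by rewrite intr_eq0; apply: vP; rewrite mem_head.
    have := sinh_zero_unique hv x0 fj fj0.
    rewrite /harmonic => /invr_inj /eqP; rewrite eqr_nat eqSS => /eqP e.
    by rewrite e ltnn in ltj.
  exists (maxn J J') => j; rewrite geq_max => /andP [Jj J'j].
  rewrite /fun_den big_cons mulf_neq0 //; first exact: J'P.
  exact: JP.
have [J JP] := ev.
move=> /nbhs_ballP [e /= e0 pe].
have re0 : 0 < complex.Re e by move: e0; rewrite ltcE => /andP [].
pose V : R := 1 + \sum_k `|(v 0 k)%:~R|.
have V0 : 0 < V by rewrite ltr_pwDl // sumr_ge0.
have : 0 < complex.Re e / V by rewrite divr_gt0.
move/cvgrPdist_lt: (@cvg_harmonic R) => /[apply] -[N _ NP].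
pose j := maxn N J; have /(JP j) : (J <= j)%N by rewrite leq_maxr.
move/eqP; apply; apply: pe; split => // i k.
have /NP /= : (N <= j)%N by rewrite leq_maxl.
rewrite sub0r normrN ltr_pdivlMr // => lt.
rewrite -ball_normE /ball_ /= !mxE opprD addrA subrr sub0r normrN normrM.
have -> : (v i k)%:~R = cofR (v 0 k)%:~R :> C by rewrite /cofR rmorph_int (ord1 i).
rewrite !norm_cofR -cofRM [ltRHS](cofR_Re (gtr0_real e0)) /cofR ltcR.
apply: le_lt_trans lt; apply: ler_wpM2l => //.
by rewrite /V (bigD1 k) //= addrCA lerDl addr_ge0 // sumr_ge0.
Qed.

End Denominator.

(** * The generating function of a twisted trace *)

Theorem theorem3p2 (R : realType) (d n : nat)
    (xi : 'I_n -> 'rV[int]_d) (b : 'I_n -> Cx R)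
    (A : algType (Cx R)) (iota : {lrmorphism {mpoly (Cx R)[d]} -> A})
    (r : 'rV[int]_d -> A) (hA : is_coulomb_branch xi b iota r)
    (zeta : 'rV[Cx R]_d) (g : {lrmorphism A -> A}) (hg : is_twist iota r zeta g)
    (T : {scalar A}) (hT : is_twisted_trace g T)
    (lam : {vspace 'rV[Cx R]_d} -> 'rV[int]_d)
    (hlam : forall l, l \in lines R xi -> is_shortest l (lam l)) :
  exists (M : seq 'rV[Cx R]_d) (S : 'rV[Cx R]_d -> {mpoly (Cx R)[d]}),
    [/\ uniq M,
        fps_is_fraction (exp_genfun iota T) (fps_num M S)
          (fps_den zeta (lines R xi) lam) &
        exists f : 'rV[Cx R]_d -> Cx R,
          [/\ meromorphic f,
              has_expansion f 0 (exp_genfun iota T) &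
              forall z, fun_den zeta (lines R xi) lam z != 0 ->
                f z = fun_num M S z / fun_den zeta (lines R xi) lam z]].
Proof.
set L := lines R xi; set u := exp_genfun iota T; set D := fps_den zeta L lam.
have nz l : l \in L -> lam l != 0 by move=> /hlam [].
have lT : scalar (T \o iota) := T0_scalar iota T.
have uE : u = genfun (T \o iota) by [].
have uD M S : genfun (shift_diffs zeta L lam (T \o iota)) = fps_num M S ->
    fps_mul u D = fps_num M S.
  by move=> <-; rewrite (genfun_shift_diffs _ _ _ lT) -uE fps_mulC.
have [M [S [M_uniq {uD} uD]]] : exists M S, uniq M /\ fps_mul u D = fps_num M S.
  have [flat0|flat_neq0] := eqVneq (flat R xi [set: 'I_n]%SET) 0%VS.
    have [M [S [M_uniq MS]]] := quasipoly_fps_num (quasipoly_shift_diffs hA hg hT flat0 hlam).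
    by exists M, S; split=> //; apply: uD.
  (* All weights vanish at l, so u (e^(l/2) - q e^(-l/2)) = 0. *)
  have [l l0 lxi] := integral_point_of_flat flat_neq0.
  have u0 : u = (fun=> 0).
    apply: (@sinh_mul_eq0 _ _ (twist_factor zeta l) l) => //.
    rewrite fps_mulC uE -genfun_shift_diff // (shift_diff_trace_eq0 hA hg hT lxi).
    by apply/funext => m; rewrite /genfun mul0r.
  exists [::], (fun=> 0); split=> //; apply/funext => m.
  by rewrite u0 /fps_num big_nil /fps_mul big1 // => k _; rewrite mul0r.
exists M, S; split=> //.
  split; last by move=> m; rewrite uD.
  apply: contrapT => D0; apply: (fps_den_neq0 (zeta := zeta) nz).
  apply/funext => m; apply/eqP; apply: contrapT => /negP Dm.
  by apply: D0; exists m.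
pose den := fun_den zeta L lam; pose num := fun_num M S.
(* Where the denominator vanishes f is given the sum of the series u, so that
   near 0 it is this sum at every point. *)
pose f z := if den z != 0 then num z / den z else (lim (psum (scale z u) @ \oo))%classic.
have u_geometric : geometric u.
  apply: (geometric_den (zeta := zeta) nz); rewrite -/D uD.
  have [B BP] := evals_abs_bounded (fun z => ex_intro _ _ (evals_num M S z)).
  exact: geometric_abs_bounded BP.
exists f; split.
- move=> p; exists num, den; split.
  + apply: (@filterE _ (nbhs p) (nbhs_filter p)) => z.
    exact/entire_holomorphic/entire_num.
  + apply: (@filterE _ (nbhs p) (nbhs_filter p)) => z.
    exact/entire_holomorphic/entire_den.
  + exact: fun_den_not_near0.
  + by apply: (@filterE _ (nbhs p) (nbhs_filter p)) => z dz; rewrite /f dz.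
- rewrite /has_expansion; apply: (filterS _ (geometric_near0 u_geometric)) => z [B BP].
  have [l ul] := abs_sums BP; rewrite subr0; split; first by exists B.
  have [_ ulim] := ul; rewrite /f; case: ifPn => [dz|_].
    have := evalsM ul (evals_den zeta L lam z); rewrite -/D uD.
    move=> /evals_unique /(_ (evals_num M S z)) e.
    by rewrite /num -e -/den mulfK.
  by rewrite (cvg_lim _ ulim).
- by move=> z dz; rewrite /f -/den dz.
Qed.
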